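(* Let $R$ be a commutative integral domain with identity and let $\Gamma$ be a discrete group with identity $e$. For $i=1,2$, let $\mathcal{G}_i$ be an ample Hausdorff groupoid and $c_i:\mathcal{G}_i\to\Gamma$ a continuous cocycle such that there is a dense subset $X_i\subseteq\mathcal{G}_i^0$ with the property that the group ring $R\big(c_i^{-1}(e)\cap(\mathcal{G}_i)_x^x\big)$ has no zero-divisors and only trivial units for every $x\in X_i$. Then the following are equivalent: (1) there is an isomorphism of topological groupoids $\psi:\mathcal{G}_1\to\mathcal{G}_2$ with $c_2\circ\psi=c_1$; (2) there is a diagonal-preserving graded $*$-algebra isomorphism $A_R(\mathcal{G}_1)\to A_R(\mathcal{G}_2)$; (3) there is a diagonal-preserving graded ring isomorphism $A_R(\mathcal{G}_1)\to A_R(\mathcal{G}_2)$.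
   Context: $R$ is assumed to carry an involution $r\mapsto r^*$ which is a ring automorphism (possibly the identity). An ample Hausdorff groupoid is a Hausdorff topological groupoid $\mathcal{G}$ whose range and source maps $r(\eta)=\eta\eta^{-1}$, $s(\eta)=\eta^{-1}\eta$ are local homeomorphisms and whose unit space $\mathcal{G}^0$ has a basis of compact open sets. A bisection is a subset $U\subseteq\mathcal{G}$ on which $r$ and $s$ restrict to homeomorphisms onto open subsets of $\mathcal{G}^0$. For $x\in\mathcal{G}^0$, $\mathcal{G}_x^x=\{\eta: s(\eta)=r(\eta)=x\}$ is the isotropy group. A continuous cocycle is a continuous groupoid homomorphism $c:\mathcal{G}\to\Gamma$. The Steinberg algebra $A_R(\mathcal{G})$ is the set of locally constant compactly supported functions $\mathcal{G}\to R$ with pointwise addition and $R$-scaling, convolution product $(f*g)(\eta)=\sum_{\alpha\beta=\eta}f(\alpha)g(\beta)$, and involution $f^*(\eta)=(f(\eta^{-1}))^*$. The diagonal $D_R(\mathcal{G})$ is the commutative subalgebra of $A_R(\mathcal{G})$ consisting of functions supported in the clopen set $\mathcal{G}^0$. A continuous cocycle $c$ induces the $\Gamma$-grading $A_R(\mathcal{G})_g=\{f\in A_R(\mathcal{G}):\operatorname{supp}(f)\subseteq c^{-1}(g)\}$, where $\operatorname{supp}(f)=\{\eta: f(\eta)\neq0\}$. An isomorphism $\phi:A_R(\mathcal{G}_1)\to A_R(\mathcal{G}_2)$ is diagonal-preserving if $\phi(D_R(\mathcal{G}_1))=D_R(\mathcal{G}_2)$ and graded if $\phi(A_R(\mathcal{G}_1)_g)=A_R(\mathcal{G}_2)_g$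 for all $g\in\Gamma$. For a group $H$, the group ring $RH$ ''has no zero-divisors and only trivial units'' means $ab=0\Rightarrow a=0$ or $b=0$ in $RH$, and every two-sided invertible element of $RH$ has the form $uh$ with $u\in R$, $h\in H$. *)

(* Defs.v *)
From HB Require Import structures.
From mathcomp Require Import all_boot all_algebra.
From Stdlib Require List.
Set Implicit Arguments. Unset Strict Implicit. Unset Printing Implicit Defensive.
Import GRing.Theory.
Local Open Scope ring_scope.

Record topology (T : Type) := Topology {
  is_open : (T -> Prop) -> Prop;
  open_full : is_open (fun _ => True);
  open_union : forall (I : Type) (U : I -> T -> Prop),
      (forall i, is_open (U i)) -> is_open (fun x => exists i, U i x);
  open_inter : forall U V, is_open U -> is_open V -> is_open (fun x => U x /\ V x)
}.

Definition subset {T : Type} (A B : T -> Prop) := forall x, A x -> B x.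

Definition compact {T : Type} (tau : topology T) (K : T -> Prop) : Prop :=
  forall (I : Type) (U : I -> T -> Prop),
    (forall i, is_open tau (U i)) ->
    subset K (fun x => exists i, U i x) ->
    exists l : list I, subset K (fun x => exists i, List.In i l /\ U i x).

Definition hausdorff {T : Type} (tau : topology T) : Prop :=
  forall x y : T, x <> y -> exists U V, is_open tau U /\ is_open tau V /\
    U x /\ V y /\ (forall z, ~ (U z /\ V z)).

Definition rel_open {T : Type} (tau : topology T) (Y A : T -> Prop) : Prop :=
  exists W, is_open tau W /\ forall x, (A x <-> (W x /\ Y x)).

Definition continuous {T S : Type} (tT : topology T) (tS : topology S)
  (f : T -> S) : Prop :=
  forall V, is_open tS V -> is_open tT (fun x => V (f x)).

(* Groupoids (Renault's definition, with an explicit set of composable *)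
(* pairs and total operations that only matter on composable pairs).   *)

Record groupoid := Groupoid {
  gcarrier :> Type;
  gcomp : gcarrier -> gcarrier -> Prop;
  gmul : gcarrier -> gcarrier -> gcarrier;     (* a b, meaningful on G^(2) *)
  ginv : gcarrier -> gcarrier;
  gtop : topology gcarrier;
  gcomp_assoc_l : forall a b c, gcomp a b -> gcomp b c -> gcomp (gmul a b) c;
  gcomp_assoc_r : forall a b c, gcomp a b -> gcomp b c -> gcomp a (gmul b c);
  gmul_assoc : forall a b c, gcomp a b -> gcomp b c ->
      gmul (gmul a b) c = gmul a (gmul b c);
  ginvK : forall a, ginv (ginv a) = a;
  gcomp_inv : forall a, gcomp a (ginv a);
  gmulKl : forall a b, gcomp a b -> gmul (ginv a) (gmul a b) = b;
  gmulKr : forall a b, gcomp a b -> gmul (gmul a b) (ginv b) = a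
}.

Section GroupoidDefs.
Variable G : groupoid.

Definition grange (e : G) : G := gmul e (ginv e).
Definition gsource (e : G) : G := gmul (ginv e) e.

Definition unit_space (x : G) : Prop := exists e : G, x = grange e.

Definition topological_groupoid : Prop :=
  (forall (U : G -> Prop) (a b : G), is_open (gtop G) U -> gcomp a b -> U (gmul a b) ->
     exists A B, is_open (gtop G) A /\ is_open (gtop G) B /\ A a /\ B b /\
       forall a' b', A a' -> B b' -> gcomp a' b' -> U (gmul a' b'))
  /\ continuous (gtop G) (gtop G) (@ginv G).

Definition local_homeo_onto (Y : G -> Prop) (f : G -> G) : Prop :=
  (forall e, Y (f e)) /\
  (forall V, rel_open (gtop G) Y V -> is_open (gtop G) (fun e => V (f e))) /\
  forall e : G, exists U, is_open (gtop G) U /\ U e /\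
    (forall a b, U a -> U b -> f a = f b -> a = b) /\
    (forall V, is_open (gtop G) V -> subset V U ->
       rel_open (gtop G) Y (fun y => exists v, V v /\ y = f v)).

Definition ample_hausdorff : Prop :=
  topological_groupoid /\ hausdorff (gtop G) /\
  local_homeo_onto unit_space grange /\ local_homeo_onto unit_space gsource /\
  (forall (W : G -> Prop) (x : G), rel_open (gtop G) unit_space W -> W x ->
     exists K, rel_open (gtop G) unit_space K /\ compact (gtop G) K /\ K x /\ subset K W).

Definition dense_in_unit_space (X : G -> Prop) : Prop :=
  subset X unit_space /\
  forall W, is_open (gtop G) W -> (exists x, W x /\ unit_space x) -> exists x, W x /\ X x.

Definition isotropy (x : G) (e : G) : Prop := gsource e = x /\ grange e = x.

Variable R : idomainType.

Definition supp (f : G -> R) (e : G) : Prop := f e <> 0.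

Definition steinberg (f : G -> R) : Prop :=
  (forall e, exists U, is_open (gtop G) U /\ U e /\ forall e', U e' -> f e' = f e)
  /\ compact (gtop G) (supp f).

Definition diagonal (f : G -> R) : Prop := steinberg f /\ subset (supp f) unit_space.

Definition conv (f g h : G -> R) : Prop :=
  forall e : G, exists l : list (G * G),
    List.NoDup l /\
    (forall p, List.In p l <-> (gcomp p.1 p.2 /\ gmul p.1 p.2 = e /\ f p.1 * g p.2 <> 0)) /\
    h e = \sum_(p <- l) f p.1 * g p.2.

Definition gstar (star : R -> R) (f : G -> R) : G -> R := fun e => star (f (ginv e)).

Definition cont_cocycle (Gam : groupType) (c : G -> Gam) : Prop :=
  (forall a b, gcomp a b -> c (gmul a b) = monoid.mul (c a) (c b)) /\
  (forall g : Gam, is_open (gtop G) (fun e => c e = g)).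

Definition graded_comp (Gam : groupType) (c : G -> Gam) (g : Gam) (f : G -> R) : Prop :=
  steinberg f /\ subset (supp f) (fun e => c e = g).

(* The group ring R H for the subgroup H (a predicate on G contained in the
   isotropy group at x): finitely supported functions supported in H, with
   multiplication given by convolution (which is the group-ring product). *)
Definition group_ring_elt (H : G -> Prop) (a : G -> R) : Prop :=
  (exists l : list G, subset (supp a) (fun e => List.In e l)) /\ subset (supp a) H.

Definition is_delta (h : G) (u : R) (a : G -> R) : Prop :=
  a h = u /\ forall e, e <> h -> a e = 0.

Definition grring_nzd_trivial_units (H : G -> Prop) (x : G) : Prop :=
  (forall a b ab, group_ring_elt H a -> group_ring_elt H b -> conv a b ab ->
     (forall e, ab e = 0) -> (forall e, a e = 0) \/ (forall e, b e = 0)) /\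
  (forall a, group_ring_elt H a ->
     (exists b, group_ring_elt H b /\
        (exists h, conv a b h /\ is_delta x 1 h) /\
        (exists h, conv b a h /\ is_delta x 1 h)) ->
     exists (u : R) (h : G), H h /\ is_delta h u a).

End GroupoidDefs.

Definition groupoid_iso (G1 G2 : groupoid) (psi : G1 -> G2) : Prop :=
  (exists phi : G2 -> G1, cancel psi phi /\ cancel phi psi /\
     continuous (gtop G2) (gtop G1) phi) /\
  continuous (gtop G1) (gtop G2) psi /\
  (forall a b, gcomp a b <-> gcomp (psi a) (psi b)) /\
  (forall a b, gcomp a b -> psi (gmul a b) = gmul (psi a) (psi b)).

Section AlgIso.
Variables (G1 G2 : groupoid) (R : idomainType) (Gam : groupType)
  (c1 : G1 -> Gam) (c2 : G2 -> Gam).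

Definition ring_iso (phi : (G1 -> R) -> (G2 -> R)) : Prop :=
  (forall f, steinberg f -> steinberg (phi f)) /\
  (forall f g, steinberg f -> steinberg g -> phi f = phi g -> f = g) /\
  (forall g, steinberg g -> exists f, steinberg f /\ phi f = g) /\
  (forall f g, steinberg f -> steinberg g -> phi (fun e => f e + g e) = (fun e => phi f e + phi g e)) /\
  (forall f g h, steinberg f -> steinberg g -> steinberg h ->
     conv f g h -> conv (phi f) (phi g) (phi h)).

Definition star_alg_iso (star : R -> R) (phi : (G1 -> R) -> (G2 -> R)) : Prop :=
  ring_iso phi /\
  (forall (r : R) f, steinberg f -> phi (fun e => r * f e) = (fun e => r * phi f e)) /\
  (forall f, steinberg f -> phi (gstar star f) = gstar star (phi f)).

Definition diagonal_preserving (phi : (G1 -> R) -> (G2 -> R)) : Prop :=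
  (forall f, diagonal f -> diagonal (phi f)) /\
  (forall g, diagonal g -> exists f, diagonal f /\ phi f = g).

Definition graded (phi : (G1 -> R) -> (G2 -> R)) : Prop :=
  forall g : Gam,
  (forall f, graded_comp c1 g f -> graded_comp c2 g (phi f)) /\
  (forall h, graded_comp c2 g h -> exists f, graded_comp c1 g f /\ phi f = h).

End AlgIso.

(* Main.v *)
From HB Require Import structures.
From mathcomp Require Import all_boot all_algebra.
From mathcomp Require Import boolp.
From Stdlib Require List Permutation FinFun.
Require Import Defs.
Import GRing.Theory.
Local Open Scope ring_scope.
Set Implicit Arguments. Unset Strict Implicit. Unset Printing Implicit Defensive.

(** The point of the proof is (3) => (1).  Call [n] of degree [g] a normaliser
    when some [m] of degree [g^-1] satisfies [n m n = n], [m n m = m],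
    [n D m <= D] and [m D n <= D], a notion preserved by diagonal-preserving
    graded isomorphisms.  For [x] in the dense set, the part of [n] with source
    [x] translates to elements of the group ring of the degree-[e] isotropy at
    [x]; absence of zero divisors confines it to a single range, where it
    becomes a unit, hence trivial.  By density the support of [n] is a
    bisection and its values are units; conversely every unit-valued function
    of degree [g] on a compact open bisection is a normaliser.  These supports
    form a basis of compact open sets on either side.  Cutting normalisers by
    idempotents of the diagonal transports intersections from one side to the
    other, so points, being determined by the members of the basis that contain
    them, correspond by compactness; products of normalisers transport the
    groupoid law. *)

Lemma eq_pred (T : Type) (A B : T -> Prop) : (forall x, A x <-> B x) -> A = B.
Proof. by move=> h; apply: funext => x; apply/propext. Qed.

(** * Finitely supported sums *)

Section FiniteSums.
Variable V : nmodType.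

(** A relation, because the sum exists only when finitely many terms are nonzero; the
    repetition-free list has the same shape as in [conv] and asks for no decidable equality on
    [T]. *)
Definition fsum (T : Type) (A : T -> Prop) (F : T -> V) (v : V) : Prop :=
  exists l : list T, List.NoDup l /\
    (forall p, List.In p l <-> A p /\ F p <> 0) /\ v = \sum_(p <- l) F p.

Lemma eq_sum_list (T : Type) (l : list T) (F F' : T -> V) :
  (forall p, List.In p l -> F p = F' p) -> \sum_(p <- l) F p = \sum_(p <- l) F' p.
Proof.
elim: l => [|x l IH] h; first by rewrite !big_nil.
rewrite !big_cons IH ?(h x) //; first by left.
by move=> p hp; apply: h; right.
Qed.

Lemma sum_list_map (T S : Type) (h : T -> S) (l : list T) (F : S -> V) :
  \sum_(q <- List.map h l) F q = \sum_(p <- l) F (h p).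
Proof. by elim: l => [|x l IH]; rewrite ?big_nil // /= !big_cons IH. Qed.

Lemma sum_list_perm (T : Type) (l l' : list T) (F : T -> V) :
  Permutation.Permutation l l' -> \sum_(p <- l) F p = \sum_(p <- l') F p.
Proof.
elim=> [|x m m' _ IH|x y m|m1 m2 m3 _ IH1 _ IH2] //.
- by rewrite !big_cons IH.
- by rewrite !big_cons addrCA.
- by rewrite IH1.
Qed.

Lemma fsum_unique (T : Type) (A : T -> Prop) (F : T -> V) (v w : V) :
  fsum A F v -> fsum A F w -> v = w.
Proof.
move=> [l [nl [hl ->]]] [m [nm [hm ->]]]; apply: sum_list_perm.
apply: Permutation.NoDup_Permutation => // x.
by rewrite hl hm.
Qed.

(** Only nonzero terms have to correspond, so [h] and [k] may take meaningless values elsewhere, as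
    groupoid products do on non-composable pairs. *)
Lemma fsum_bij (T S : Type) (A : T -> Prop) (B : S -> Prop) (F : T -> V)
    (F' : S -> V) (h : T -> S) (k : S -> T) (v : V) :
  (forall p, A p -> F p <> 0 -> [/\ B (h p), F' (h p) = F p & k (h p) = p]) ->
  (forall q, B q -> F' q <> 0 -> [/\ A (k q), F (k q) <> 0 & h (k q) = q]) ->
  fsum A F v -> fsum B F' v.
Proof.
move=> hA hB [l [nl [hl ->]]]; exists (List.map h l); split; [|split].
- apply: FinFun.Injective_map_NoDup_in => // x y /hl[Ax Fx] /hl[Ay Fy] e.
  by have [_ _ <-] := hA _ Ax Fx; have [_ _ <-] := hA _ Ay Fy; rewrite e.
- move=> q; rewrite List.in_map_iff; split.
    by move=> [p [<- /hl[Ap Fp]]]; have [Bp -> _] := hA _ Ap Fp.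
  by move=> [Bq Fq]; have [Ak Fk e] := hB _ Bq Fq; exists (k q); rewrite hl.
- rewrite sum_list_map; apply: eq_sum_list => p /hl[Ap Fp].
  by have [_ -> _] := hA _ Ap Fp.
Qed.

Lemma fsum_ext (T : Type) (A B : T -> Prop) (F F' : T -> V) (v : V) :
  (forall p, A p /\ F p <> 0 <-> B p /\ F' p <> 0) ->
  (forall p, A p -> F p <> 0 -> F' p = F p) -> fsum A F v -> fsum B F' v.
Proof.
move=> h1 h2; apply: (@fsum_bij _ _ _ _ _ _ id id).
- by move=> p Ap Fp; have /h1[] := conj Ap Fp; split=> //; apply: h2.
- by move=> p Bp Fp; have /h1[] := conj Bp Fp.
Qed.

Lemma fsum0 (T : Type) (A : T -> Prop) (F : T -> V) :
  (forall p, A p -> F p = 0) -> fsum A F 0.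
Proof.
move=> h; exists nil; split; [exact: List.NoDup_nil|split; last by rewrite big_nil].
by move=> p; split=> [[]|[Ap]]; rewrite h.
Qed.

Lemma fsum1 (T : Type) (A : T -> Prop) (F : T -> V) (p : T) :
  A p -> (forall q, A q -> F q <> 0 -> q = p) -> fsum A F (F p).
Proof.
move=> Ap h; have [z|nz] := eqVneq (F p) 0.
  rewrite z; apply: fsum0 => q Aq; apply: contrapT => Fq.
  by apply: (Fq); rewrite (h q Aq Fq).
exists [:: p]; split; [|split; last by rewrite big_seq1].
  by constructor; [move=> []|exact: List.NoDup_nil].
move=> q; split=> [[<-|[]]|[Aq Fq]]; last by left; rewrite (h q Aq Fq).
by split=> //; apply/eqP.
Qed.

Lemma fsum_neq0 (T : Type) (A : T -> Prop) (F : T -> V) (v : V) :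
  fsum A F v -> v <> 0 -> exists p, A p /\ F p <> 0.
Proof.
move=> hv nz; apply: contrapT => h; apply: nz; apply: (fsum_unique hv).
by apply: fsum0 => p Ap; apply: contrapT => Fp; apply: h; exists p.
Qed.

End FiniteSums.

(** * Topology *)

Section Topology.
Variables (T : Type) (tau : topology T).
Implicit Types (A K O : T -> Prop).

Lemma open_local A :
  (forall x, A x -> exists U, is_open tau U /\ U x /\ subset U A) -> is_open tau A.
Proof.
move=> h; pose I := {U : T -> Prop | is_open tau U /\ subset U A}.
have := @open_union _ tau I (fun i => sval i) (fun i => (svalP i).1).
rewrite (_ : (fun x => _) = A) //; apply: eq_pred => x; split.
  by move=> [[U [oU sU]] /= Ux]; exact: sU.
by move=> /h[U [oU [Ux sU]]]; exists (exist _ U (conj oU sU)).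
Qed.

Lemma open_inter_list (I : Type) (l : list I) (V : I -> T -> Prop) :
  (forall i, List.In i l -> is_open tau (V i)) ->
  is_open tau (fun x => forall i, List.In i l -> V i x).
Proof.
elim: l => [|j l IH] h.
  by rewrite (_ : (fun x => _) = fun=> True) //; [exact: open_full|exact: eq_pred].
rewrite (_ : (fun x => _) = fun x => V j x /\ forall i, List.In i l -> V i x).
  apply: open_inter; first by apply: h; left.
  by apply: IH => i hi; apply: h; right.
apply: eq_pred => x; split=> [H|[H1 H2] i [<-|]]; auto.
by split=> [|i hi]; apply: H; [left|right].
Qed.

Lemma compact_closed K :
  hausdorff tau -> compact tau K -> is_open tau (fun x => ~ K x).
Proof.
move=> hT cK; apply: open_local => z nKz.
pose I := {UV : (T -> Prop) * (T -> Prop) | [/\ is_open tau UV.1, is_open tau UV.2,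
  UV.2 z & forall y, ~ (UV.1 y /\ UV.2 y)]}.
have [||l hl] := cK I (fun i => (sval i).1).
- by move=> [[U V] []].
- move=> k Kk; have kz : k <> z by move=> e; apply: nKz; rewrite -e.
  have [U [V [oU [oV [Uk [Vz d]]]]]] := hT _ _ kz.
  have UVP : [/\ is_open tau (U, V).1, is_open tau (U, V).2, (U, V).2 z
    & forall y, ~ ((U, V).1 y /\ (U, V).2 y)] by split.
  by exists (exist _ (U, V) UVP).
exists (fun x => forall i : I, List.In i l -> (sval i).2 x); split; [|split].
- by apply: open_inter_list => -[[U V] []].
- by move=> [[U V] []].
- by move=> x hx /hl[i [il Ui]]; case: (svalP i) => _ _ _ /(_ x); apply; auto.
Qed.

Lemma compact_sub_closed K A :
  compact tau K -> subset A K -> is_open tau (fun x => ~ A x) -> compact tau A.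
Proof.
move=> cK sA oA I U oU cU.
(* The index [None] adds the complement of [A] to the cover; containing no point of [A], it is
   dropped from the finite subcover afterwards. *)
have [||l hl] := cK (option I) (fun i => if i is Some j then U j else fun x => ~ A x).
- by case.
- move=> x Kx; have [/cU[i Ui]|nA] := pselect (A x); first by exists (Some i).
  by exists None.
exists (List.flat_map (fun i => if i is Some j then [:: j] else [::]) l) => x Ax.
have [[i|] [il Ui]] := hl _ (sA _ Ax); last by case: Ui.
by exists i; split=> //; apply/List.in_flat_map; exists (Some i); split=> //; left.
Qed.

(** Without a common point the complements of the [C i] cover [C i0]. Directedness provides a
    nonempty [C k] inside [C i0] and inside all [C i] of a finite subcover, a contradiction. *)
Lemma compact_directed (I : Type) (i0 : I) (C : I -> T -> Prop) :
  (forall i, compact tau (C i)) -> (forall i, is_open tau (fun x => ~ C i x)) ->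
  (forall i, exists x, C i x) ->
  (forall i j, exists k, subset (C k) (fun x => C i x /\ C j x)) ->
  exists x, forall i, C i x.
Proof.
move=> cC oC neC dC; apply: contrapT => no.
have [//||l hl] := cC i0 I (fun i x => ~ C i x).
  move=> x _; apply: contrapT => h; apply: no; exists x => i.
  by apply: contrapT => ni; apply: h; exists i.
have [k hk] : exists k, subset (C k) (C i0) /\
    forall i, List.In i l -> subset (C k) (C i).
  elim: l {hl} => [|j l [k [hk0 hk]]]; first by exists i0; split.
  have [k' hk'] := dC j k; exists k'; split=> [x /hk'[_ /hk0]//|i [<-|il]] x /hk'[] //.
  by move=> _; exact: hk.
have [x Cx] := neC k; have [i [il]] := hl _ (hk.1 _ Cx).
by apply; apply: hk.2 Cx.
Qed.

Lemma open_avoid_list (l : list T) (x : T) : hausdorff tau ->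
  exists W, is_open tau W /\ W x /\ forall u, List.In u l -> u <> x -> ~ W u.
Proof.
move=> hT; elim: l => [|u l [W [oW [Wx hW]]]].
  by exists (fun=> True); split=> //; exact: open_full.
have [e|ne] := pselect (u = x).
  by exists W; split=> //; split=> // w [<-|/hW].
have [U [V [oU [oV [Uu [Vx d]]]]]] := hT _ _ ne.
exists (fun y => W y /\ V y); split; first exact: open_inter.
split=> // w [<- _ [_ Vu]|wl nw [Ww _]]; first exact: (d u).
exact: hW wl nw Ww.
Qed.

End Topology.

(* The image is taken under a relation, so that sections of a local
   homeomorphism need not be turned into total functions. *)
Lemma compact_image (T S : Type) (tT : topology T) (tS : topology S)
    (K : T -> Prop) (Q : T -> S -> Prop) :
  compact tT K ->
  (forall k, K k -> exists y0, Q k y0 /\ forall O, is_open tS O -> O y0 ->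
     exists U, is_open tT U /\ U k /\ forall u y, U u -> K u -> Q u y -> O y) ->
  compact tS (fun y => exists k, K k /\ Q k y).
Proof.
move=> cK hQ I O oO cO.
pose J := {iU : I * (T -> Prop) | is_open tT iU.2 /\
  forall u y, iU.2 u -> K u -> Q u y -> O iU.1 y}.
have [||l hl] := cK J (fun j => (sval j).2).
- by move=> [[i U] []].
- move=> k Kk; have [y0 [Qy h]] := hQ _ Kk.
  have [i Oi] : exists i, O i y0 by apply: cO; exists k.
  have [U [oU [Uk hU]]] := h _ (oO i) Oi.
  by exists (exist _ (i, U) (conj oU hU)).
exists (List.map (fun j : J => (sval j).1) l) => y [k [Kk Qk]].
have [j [jl Uj]] := hl _ Kk; exists (sval j).1; split; first exact: List.in_map.
exact: (svalP j).2 Uj Kk Qk.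
Qed.

Lemma compact_image_fun (T S : Type) (tT : topology T) (tS : topology S)
    (K : T -> Prop) (f : T -> S) :
  compact tT K -> continuous tT tS f -> compact tS (fun y => exists k, K k /\ y = f k).
Proof.
move=> cK cf; apply: (@compact_image _ _ tT tS K (fun k y => y = f k)) => // k Kk.
exists (f k); split=> // O oO Ofk; exists (fun x => O (f x)); split; first exact: cf.
by split=> // u y Ou _ ->.
Qed.

(** * Groupoid algebra *)

Section GroupoidTheory.
Variable G : groupoid.
Implicit Types a b e u x : G.

Lemma gcompVl a : gcomp (ginv a) a.
Proof. by have := gcomp_inv (ginv a); rewrite ginvK. Qed.

Lemma grangeV a : grange (ginv a) = gsource a.
Proof. by rewrite /grange ginvK. Qed.

Lemma gsourceV a : gsource (ginv a) = grange a.
Proof. by rewrite /gsource ginvK. Qed.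

Lemma gmul_source a : gmul a (gsource a) = a.
Proof.
rewrite /gsource -gmul_assoc; [|exact: gcomp_inv|exact: gcompVl].
by have := gmulKr (gcomp_inv a); rewrite ginvK.
Qed.

(** Bracketing [a^-1 (a b) b^-1] in two ways gives the range of [b] and the source of [a].
    Conversely, [a] composes with its source and [b] with its range, and associativity joins the two
    at this common unit. *)
Lemma gcompP a b : gcomp a b <-> gsource a = grange b.
Proof.
split=> [ab|e].
  have h1 : gcomp (ginv a) (gmul a b) by apply: gcomp_assoc_r => //; exact: gcompVl.
  have h2 : gcomp (gmul a b) (ginv b) by apply: gcomp_assoc_l => //; exact: gcomp_inv.
  have := gmul_assoc h1 h2; rewrite gmulKr // gmulKl //; by move=> <-.
have h : gcomp a (gsource a) by apply: gcomp_assoc_r; [exact: gcomp_inv|exact: gcompVl].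
have h' : gcomp (grange b) b by apply: gcomp_assoc_l; [exact: gcomp_inv|exact: gcompVl].
by rewrite -e in h'; have := gcomp_assoc_l h h'; rewrite gmul_source.
Qed.

Lemma gmul_range a : gmul (grange a) a = a.
Proof.
rewrite /grange gmul_assoc; [|exact: gcomp_inv|exact: gcompVl].
by have := gmulKl (gcompVl a); rewrite ginvK.
Qed.

Lemma grangeM a b : gcomp a b -> grange (gmul a b) = grange a.
Proof.
move=> ab; have /gcompP <- : gcomp (ginv a) (gmul a b).
  by apply: gcomp_assoc_r => //; exact: gcompVl.
exact: gsourceV.
Qed.

Lemma gsourceM a b : gcomp a b -> gsource (gmul a b) = gsource b.
Proof.
move=> ab; have /gcompP -> : gcomp (gmul a b) (ginv b).
  by apply: gcomp_assoc_l => //; exact: gcomp_inv.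
exact: grangeV.
Qed.

Lemma unit_range a : unit_space (grange a).
Proof. by exists a. Qed.

Lemma unit_source a : unit_space (gsource a).
Proof. by exists (ginv a); rewrite grangeV. Qed.

Lemma grange_unit x : unit_space x -> grange x = x.
Proof. by move=> [e ->]; rewrite {2}/grange grangeM //; exact: gcomp_inv. Qed.

Lemma gsource_unit x : unit_space x -> gsource x = x.
Proof.
by move=> [e ->]; rewrite {1}/grange gsourceM ?gsourceV //; exact: gcomp_inv.
Qed.

Lemma unit_idempotent u : gcomp u u -> gmul u u = u -> unit_space u.
Proof. by move=> uu e; have := gmulKl uu; rewrite e => <-; exact: unit_source. Qed.

Lemma unit_idem x : unit_space x -> gcomp x x /\ gmul x x = x.
Proof.
move=> ux; split; first by apply/gcompP; rewrite gsource_unit ?grange_unit.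
by rewrite -{2}(gsource_unit ux) gmul_source.
Qed.

Lemma ginv_unique a b : gcomp a b -> unit_space (gmul a b) -> b = ginv a.
Proof.
move=> ab u; rewrite -(gmulKl ab) -(grange_unit u) grangeM // -gsourceV.
exact: gmul_source.
Qed.

Lemma gmulVK a e : grange a = grange e -> gmul a (gmul (ginv a) e) = e.
Proof.
move=> h; rewrite -gmul_assoc; [|exact: gcomp_inv|by apply/gcompP; rewrite gsourceV].
by rewrite -[gmul a _]/(grange a) h gmul_range.
Qed.

Lemma gmulKV e b : gsource e = gsource b -> gmul (gmul e (ginv b)) b = e.
Proof.
move=> h; rewrite gmul_assoc; [|by apply/gcompP; rewrite grangeV|exact: gcompVl].
by rewrite -[gmul _ b]/(gsource b) -h gmul_source.
Qed.

Section Cocycle.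
Variables (Gam : groupType) (c : G -> Gam).
Hypothesis hc : cont_cocycle c.

Lemma cocycleM a b : gcomp a b -> c (gmul a b) = (c a * c b)%g.
Proof. exact: hc.1. Qed.

Lemma cocycle_unit x : unit_space x -> c x = 1%g.
Proof.
move=> /unit_idem[xx e]; apply: (@mulgI _ (c x)).
by rewrite -cocycleM // e mulg1.
Qed.

Lemma cocycleV a : c (ginv a) = ((c a)^-1)%g.
Proof.
apply: (@mulgI _ (c a)); rewrite -cocycleM ?mulgV; last exact: gcomp_inv.
exact/cocycle_unit/unit_range.
Qed.

End Cocycle.
End GroupoidTheory.

(** * Ample Hausdorff groupoids *)

Section Ample.
Variable G : groupoid.
Hypothesis hG : ample_hausdorff G.
Local Notation tau := (gtop G).
Implicit Types (U V W K O A B : G -> Prop) (a b e x : G).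

Let rlh : local_homeo_onto (@unit_space G) (@grange G) := hG.2.2.1.
Let slh : local_homeo_onto (@unit_space G) (@gsource G) := hG.2.2.2.1.

Lemma ginv_cont V : is_open tau V -> is_open tau (fun e => V (ginv e)).
Proof. exact: hG.1.2. Qed.

Lemma grange_cont V : is_open tau V -> is_open tau (fun e => V (grange e)).
Proof.
move=> oV; have : is_open tau (fun e => V (grange e) /\ unit_space (grange e)).
  by apply: (rlh.2.1 (fun y => V y /\ unit_space y)); exists V.
by congr (is_open _ _); apply: eq_pred => e; split=> [[]|] //; split=> //; exact: unit_range.
Qed.

Lemma gsource_cont V : is_open tau V -> is_open tau (fun e => V (gsource e)).
Proof.
move=> oV; have := ginv_cont (grange_cont oV).
by congr (is_open _ _); apply: eq_pred => e; rewrite grangeV.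
Qed.

(** Near a unit the range map is injective, so [e] and [grange e], which have the same range,
    coincide as soon as both lie in that neighbourhood. *)
Lemma unit_space_open : is_open tau (@unit_space G).
Proof.
apply: open_local => x ux; have [U [oU [Ux [inj _]]]] := rlh.2.2 x.
exists (fun e => U e /\ U (grange e)); split; [|split].
- by apply: open_inter => //; exact: grange_cont.
- by rewrite grange_unit.
- move=> e [Ue Ure]; rewrite (inj e (grange e)) //; first exact: unit_range.
  by rewrite (@grange_unit G (grange e)) //; exact: unit_range.
Qed.

Lemma grange_open V : is_open tau V -> is_open tau (fun y => exists v, V v /\ y = grange v).
Proof.
move=> oV; apply: open_local => y [v [Vv ->]].
have [U [oU [Uv [_ h]]]] := rlh.2.2 v.
have [||W [oW hW]] := h (fun e => V e /\ U e).
- exact: open_inter.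
- by move=> e [].
exists (fun y => W y /\ unit_space y); split; [|split].
- by apply: open_inter => //; exact: unit_space_open.
- by apply/hW; exists v.
- by move=> z /hW[e [[Ve _] ->]]; exists e.
Qed.

Lemma gsource_open V : is_open tau V -> is_open tau (fun y => exists v, V v /\ y = gsource v).
Proof.
move=> /ginv_cont/grange_open; congr (is_open _ _).
apply: eq_pred => y; split=> [[v [Vv ->]]|[v [Vv ->]]]; exists (ginv v).
  by rewrite gsourceV.
by rewrite ginvK grangeV.
Qed.

Lemma compact_open_unit W x : is_open tau W -> W x -> unit_space x ->
  exists K, [/\ is_open tau K, compact tau K, K x & subset K (fun y => W y /\ unit_space y)].
Proof.
move=> oW Wx ux; have hW : rel_open tau (@unit_space G) (fun y => W y /\ unit_space y).
  by exists W.
have [K [[O [oO hO]] [cK [Kx sK]]]] := hG.2.2.2.2 _ x hW (conj Wx ux).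
exists K; split=> //; rewrite (eq_pred hO).
by apply: open_inter => //; exact: unit_space_open.
Qed.

Definition inj_on A (f : G -> G) := forall a b, A a -> A b -> f a = f b -> a = b.

Definition bisection A := inj_on A (@grange G) /\ inj_on A (@gsource G).

Lemma bisection_sub A B : subset A B -> bisection B -> bisection A.
Proof. by move=> s [h1 h2]; split=> a b /s Ba /s Bb; [exact: h1|exact: h2]. Qed.

Lemma local_bisection e : exists U, [/\ is_open tau U, U e & bisection U].
Proof.
have [U [oU [Ue [iU _]]]] := rlh.2.2 e; have [V [oV [Ve [iV _]]]] := slh.2.2 e.
exists (fun y => U y /\ V y); split=> //; first exact: open_inter.
by split=> a b [Ua Va] [Ub Vb]; [exact: iU|exact: iV].
Qed.

(** [W] is the source image of the part of [A] in [O]. Diagonal elements act through sources, so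
    this makes restriction to [O] achievable by multiplication with one of them. *)
Lemma shrink_source A O a : is_open tau A -> inj_on A (@gsource G) ->
  is_open tau O -> A a -> O a ->
  exists W, [/\ is_open tau W, W (gsource a) & forall e, A e -> W (gsource e) -> O e].
Proof.
move=> oA iA oO Aa Oa; exists (fun y => exists v, (A v /\ O v) /\ y = gsource v).
split; [by apply: gsource_open; exact: open_inter|by exists a|].
by move=> e Ae [v [[Av Ov] h]]; rewrite (iA _ _ Ae Av h).
Qed.

Lemma compact_open_bisection O e : is_open tau O -> O e ->
  exists B, [/\ is_open tau B, compact tau B, B e, subset B O & bisection B].
Proof.
move=> oO Oe; have [U [oU Ue bU]] := local_bisection e.
pose A y := U y /\ O y.
have oA : is_open tau A by exact: open_inter.
have bA : bisection A by apply: bisection_sub bU => y [].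
have [K [oK cK Ke sK]] := compact_open_unit (gsource_open oA)
  (ex_intro _ e (conj (conj Ue Oe) erefl)) (unit_source e).
exists (fun y => A y /\ K (gsource y)); split=> //; last 1 first.
- by apply: bisection_sub bA => y [].
- by apply: open_inter => //; exact: gsource_cont.
(* The set is the image of the compact [K] under the inverse of the source map on [A]. *)
- rewrite (_ : (fun y => _) = fun y => exists k, K k /\ (A y /\ gsource y = k)); last first.
    apply: eq_pred => y; split=> [[Ay Ky]|[k [Kk [Ay h]]]].
      by exists (gsource y).
    by split=> //; rewrite h.
  apply: (compact_image cK (tS := tau)) => k Kk; have [[v [Av kv]] _] := sK _ Kk.
  exists v; split=> // O' oO' Ov.
  exists (fun y => exists v', (A v' /\ O' v') /\ y = gsource v'); split; [|split].
  + by apply: gsource_open; exact: open_inter.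
  + by exists v.
  + move=> u y [v' [[Av' Ov'] h]] _ [Ay hy].
    by rewrite (bA.2 y v') // hy.
- by move=> y [[]].
Qed.

End Ample.

(** * Steinberg algebras *)

Lemma mulr_neq0P (R : idomainType) (x y : R) : x * y <> 0 <-> x <> 0 /\ y <> 0.
Proof.
split=> [h|[/eqP hx /eqP hy]]; last by apply/eqP; rewrite mulf_neq0.
by split=> z; apply: h; rewrite z ?mulr0 ?mul0r.
Qed.

Section Steinberg.
Variables (G : groupoid) (R : idomainType).
Hypothesis hG : ample_hausdorff G.
Local Notation tau := (gtop G).
Implicit Types (f g h d u : G -> R) (A K O : G -> Prop) (a b e x : G).

Definition lconst f : Prop :=
  forall e, exists U, is_open tau U /\ U e /\ forall e', U e' -> f e' = f e.

Lemma lconst_level f (P : R -> Prop) : lconst f -> is_open tau (fun e => P (f e)).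
Proof.
move=> lf; apply: open_local => e Pe; have [U [oU [Ue hU]]] := lf e.
by exists U; split=> //; split=> // e' /hU; rewrite /= => ->.
Qed.

Lemma lconst_comp f (k : G -> G) :
  (forall V, is_open tau V -> is_open tau (fun e => V (k e))) ->
  lconst f -> lconst (fun e => f (k e)).
Proof.
move=> ck lf e; have [U [oU [Ue hU]]] := lf (k e).
by exists (fun e' => U (k e')); split; [exact: ck|split=> // e' /hU].
Qed.

Lemma lconst_op2 f g (op : R -> R -> R) :
  lconst f -> lconst g -> lconst (fun e => op (f e) (g e)).
Proof.
move=> lf lg e; have [U [oU [Ue hU]]] := lf e; have [V [oV [Ve hV]]] := lg e.
exists (fun y => U y /\ V y); split; first exact: open_inter.
by split=> // y [/hU -> /hV ->].
Qed.

Lemma steinberg_supp_closed f : steinberg f -> is_open tau (fun e => ~ supp f e).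
Proof. by move=> [lf _]; apply: (lconst_level (fun r => ~ (r <> 0)) lf). Qed.

Lemma steinberg_mul f u : steinberg f -> lconst u -> steinberg (fun e => f e * u e).
Proof.
move=> sf lu; split; first exact: (lconst_op2 (fun r s => r * s) sf.1 lu).
apply: (compact_sub_closed sf.2) => [e /mulr_neq0P[]//|].
by apply: (lconst_level (fun r => ~ (r <> 0))); exact: (lconst_op2 (fun r s => r * s) sf.1 lu).
Qed.

Definition ind A : G -> R := fun e => if `[< A e >] then 1 else 0.

Lemma indT A e : A e -> ind A e = 1.
Proof. by move=> h; rewrite /ind; case: asboolP. Qed.

Lemma indF A e : ~ A e -> ind A e = 0.
Proof. by move=> h; rewrite /ind; case: asboolP. Qed.

Lemma supp_ind A : supp (ind A) = A.
Proof.
apply: eq_pred => e; rewrite /supp /ind; case: asboolP => // h; split=> // _.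
by apply/eqP; rewrite oner_eq0.
Qed.

Lemma ind_supp A e : ind A e <> 0 -> A e.
Proof. by rewrite -{2}(supp_ind A). Qed.

Lemma lconst_ind A : is_open tau A -> is_open tau (fun e => ~ A e) -> lconst (ind A).
Proof.
move=> oA oC e; have [Ae|nAe] := pselect (A e).
  by exists A; split=> //; split=> // y Ay; rewrite !indT.
by exists (fun y => ~ A y); split=> //; split=> // y Ay; rewrite !indF.
Qed.

Lemma steinberg_ind K : is_open tau K -> compact tau K -> steinberg (ind K).
Proof.
move=> oK cK; split; last by rewrite supp_ind.
by apply: lconst_ind => //; apply: compact_closed => //; exact: hG.2.1.
Qed.

Lemma diagonal_ind K : is_open tau K -> compact tau K -> subset K (@unit_space G) ->
  diagonal (ind K).
Proof. by move=> oK cK sK; split; [exact: steinberg_ind|rewrite supp_ind]. Qed.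

Lemma steinberg0 : steinberg (fun _ : G => 0 : R).
Proof.
split=> [e|]; first by exists (fun=> True); split=> //; exact: open_full.
by move=> I U _ _; exists nil => x; rewrite /supp.
Qed.

Lemma lconst_source d : lconst d -> lconst (fun e => d (gsource e)).
Proof. exact/lconst_comp/gsource_cont. Qed.

(** Finitely many open bisections cover the support, and each meets the source fibre at most
    once. *)
Lemma steinberg_fiber f x : steinberg f ->
  exists L : list G, forall a, f a <> 0 -> gsource a = x -> List.In a L.
Proof.
move=> [_ cf]; pose I := {U : G -> Prop | is_open tau U /\ bisection U}.
have [||l hl] := cf I (fun i => sval i).
- by move=> [U []].
- move=> e _; have [U [oU Ue bU]] := local_bisection hG e.
  by exists (exist _ U (conj oU bU)).
have [L hL] : exists L, forall (i : I) a, List.In i l -> sval i a -> gsource a = x ->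
    List.In a L.
  elim: l {hl} => [|i l [L IH]]; first by exists nil.
  have [[a0 [ia0 sa0]]|no] := pselect (exists a, sval i a /\ gsource a = x).
    exists (a0 :: L) => j a [<-|jl] ja sa; last by right; exact: IH jl ja sa.
    by left; apply: (svalP i).2.2 => //; rewrite sa.
  by exists L => j a [<- ja sa|]; [case: no; exists a|exact: IH].
by exists L => a /hl[i [il ia]]; exact: hL il ia.
Qed.

Lemma conv_fsum f g h : conv f g h <-> forall e,
  fsum (fun p => gcomp p.1 p.2 /\ gmul p.1 p.2 = e) (fun p => f p.1 * g p.2) (h e).
Proof.
split=> H e; have [l [nl [hl hs]]] := H e; exists l; split=> //; split=> // p; rewrite hl.
  by split=> [[? []]|[[]]].
by split=> [[[]]|[? []]].
Qed.

Lemma conv_unique f g h h' : conv f g h -> conv f g h' -> h = h'.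
Proof. by move=> /conv_fsum H /conv_fsum H'; apply: funext => e; apply: fsum_unique (H e) (H' e). Qed.

Lemma conv_neq0 f g h e : conv f g h -> h e <> 0 ->
  exists a b, [/\ gcomp a b, gmul a b = e, f a <> 0 & g b <> 0].
Proof.
move=> /conv_fsum H /(fsum_neq0 (H e))[[a b] [[/= ab abe] /mulr_neq0P[fa gb]]].
by exists a, b.
Qed.

(** The left factor of a nonzero term has the range of the product, hence is [a]; cancellation then
    determines the right factor. *)
Lemma conv_eval f g h a b : inj_on (supp f) (@grange G) -> conv f g h -> f a <> 0 ->
  gcomp a b -> h (gmul a b) = f a * g b.
Proof.
move=> bf /conv_fsum H fa ab; apply: (fsum_unique (H _)).
apply: (@fsum1 _ _ _ (fun p : G * G => f p.1 * g p.2) (a, b)) => // -[a' b'] /= [ab' e].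
move=> /mulr_neq0P[fa' gb'].
have ea : a' = a by apply: bf => //; rewrite -(grangeM ab') e grangeM.
by subst a'; rewrite -(gmulKl ab) -e gmulKl.
Qed.

Definition mulD f d : G -> R := fun e => f e * d (gsource e).
(** This is [f - f d], written as multiplication by the complement of [d], which need not belong to
    the algebra when the unit space is not compact. *)
Definition mulCD f d : G -> R := fun e => f e * (1 - d (gsource e)).

Lemma steinberg_mulD f d : steinberg f -> diagonal d -> steinberg (mulD f d).
Proof. by move=> sf [[ld _] _]; apply: steinberg_mul => //; exact: lconst_source. Qed.

Lemma steinberg_mulCD f d : steinberg f -> diagonal d -> steinberg (mulCD f d).
Proof.
move=> sf [[ld _] _]; apply: steinberg_mul => //.
by have ls := lconst_source ld; apply: (lconst_op2 (fun r _ => 1 - r) ls ls).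
Qed.

Lemma mulD_mulCD f d : (fun e => mulD f d e + mulCD f d e) = f.
Proof. by apply: funext => e; rewrite /mulD /mulCD -mulrDr subrKC mulr1. Qed.

Lemma conv_diag f d : subset (supp d) (@unit_space G) -> conv f d (mulD f d).
Proof.
move=> sd; apply/conv_fsum => e; apply: (@fsum1 _ _ _ (fun p => f p.1 * d p.2) (e, gsource e)).
  split=> /=; last exact: gmul_source.
  by apply/gcompP; rewrite grange_unit //; exact: unit_source.
move=> [a b] /= [ab abe] /mulr_neq0P[_ db]; have ub := sd _ db.
by move/gcompP: (ab); rewrite grange_unit // => hb; rewrite -hb gmul_source in abe *; rewrite abe.
Qed.

(* Over a bisection the convolution has at most one term, and multiplication
   is locally invertible; this gives both local constancy and compactness. *)
Lemma conv_bisection f g : steinberg f -> bisection (supp f) -> steinberg g ->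
  exists h, steinberg h /\ conv f g h.
Proof.
move=> sf bf sg.
have oF : is_open tau (supp f) by exact: (lconst_level (fun r => r <> 0) sf.1).
have rc : continuous tau tau (@grange G) by move=> V; exact: grange_cont.
have sc : continuous tau tau (@gsource G) by move=> V; exact: gsource_cont.
have [h hc] : exists h, conv f g h.
  have := @choice G R (fun e v => fsum (fun p => gcomp p.1 p.2 /\ gmul p.1 p.2 = e)
    (fun p => f p.1 * g p.2) v) _.
  case=> [e|h hh]; last by exists h; apply/conv_fsum.
  have [[a [fa ae]]|no] := pselect (exists a, f a <> 0 /\ grange a = grange e).
    exists (f a * g (gmul (ginv a) e)).
    apply: (@fsum1 _ _ _ (fun p => f p.1 * g p.2) (a, gmul (ginv a) e)).
      have ae' : gcomp (ginv a) e by apply/gcompP; rewrite gsourceV.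
      by split=> /=; [apply/gcompP; rewrite grangeM // grangeV|rewrite gmulVK].
    move=> [a' b'] /= [ab' abe] /mulr_neq0P[fa' _].
    have ea : a' = a by apply: bf.1 => //; rewrite ae -abe grangeM.
    by subst a'; rewrite -abe gmulKl.
  exists 0; apply: fsum0 => -[a b] /= [ab abe]; apply: contrapT => /mulr_neq0P[fa _].
  by apply: no; exists a; rewrite -abe grangeM.
exists h; split=> //; split.
  move=> e; have [[a [fa ae]]|no] := pselect (exists a, f a <> 0 /\ grange a = grange e).
    have ae' : gcomp (ginv a) e by apply/gcompP; rewrite gsourceV.
    have [U1 [oU1 [U1a hU1]]] := sf.1 a.
    have [V [oV [Vb hV]]] := sg.1 (gmul (ginv a) e).
    have [A [B [oA [oB [Aa [Be hAB]]]]]] := hG.1.1 V (ginv a) e oV ae' Vb.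
    (* Near [e] the product is [f v * g (v^-1 e')], where [v] is the point of [A'] with the range of
       [e']; both factors stay constant there. *)
    pose A' y := (supp f y /\ U1 y) /\ A (ginv y).
    have oA' : is_open tau A'.
      by apply: open_inter; [exact: open_inter|exact: ginv_cont].
    exists (fun y => B y /\ exists v, A' v /\ grange y = grange v); split; [|split].
    - apply: open_inter => //; exact: (grange_cont hG (grange_open hG oA')).
    - by split=> //; exists a.
    - move=> e' [Be' [v [[[fv U1v] Av] hv]]].
      have ve : gcomp (ginv v) e' by apply/gcompP; rewrite gsourceV.
      rewrite -(gmulVK (esym hv)) -[e in RHS](gmulVK ae).
      rewrite !(conv_eval bf.1 hc) //; try by apply/gcompP; rewrite grangeM // grangeV.
      by rewrite hU1 // hV //; exact: hAB.
  (* The ranges of [supp f] form a compact, hence closed, set, and the product vanishes off it. *)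
  exists (fun e' => ~ exists a, supp f a /\ grange e' = grange a); split; [|split].
  - apply: (grange_cont hG (V := fun y => ~ exists a, supp f a /\ y = grange a)).
    by apply: compact_closed; [exact: hG.2.1|exact: (compact_image_fun sf.2 rc)].
  - by move=> [a [fa ea]]; apply: no; exists a.
  - have z e' : ~ (exists a, supp f a /\ grange e' = grange a) -> h e' = 0.
      move=> no'; apply: contrapT => /(conv_neq0 hc)[a [b [ab abe fa _]]].
      by apply: no'; exists a; rewrite -abe grangeM.
    move=> e' /z ->; rewrite z // => -[a [fa ea]]; by apply: no; exists a.
pose S y := exists a, supp f a /\ y = gsource a.
have oS : is_open tau S by exact: gsource_open.
pose B b := supp g b /\ S (grange b).
have cB : compact tau B.
  apply: (compact_sub_closed sg.2) => [b []//|].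
  apply: open_local => b nb.
  have [sb|nsb] := pselect (supp g b).
    exists (fun y => ~ S (grange y)); split; [|split].
    - apply: (grange_cont hG (V := fun y => ~ S y)).
      by apply: compact_closed; [exact: hG.2.1|exact: (compact_image_fun sf.2 sc)].
    - by move=> h1; apply: nb.
    - by move=> y h1 [].
  exists (fun y => ~ supp g y); split; first exact: steinberg_supp_closed.
  by split=> // y h1 [].
(* The support is the image of the compact [B] under multiplication by the one element of [supp f]
   composable on the left. *)
have -> : supp h = fun y => exists b, B b /\ exists a, [/\ supp f a, gcomp a b & y = gmul a b].
  apply: eq_pred => y; split=> [/(conv_neq0 hc)[a [b [ab <- fa gb]]]|[b [[gb _] [a [fa ab ->]]]]].
    exists b; split; last by exists a.
    by split=> //; exists a; split=> //; apply/esym/gcompP.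
  by rewrite /supp (conv_eval bf.1 hc) //; apply/mulr_neq0P.
apply: (compact_image cB (Q := fun b y => exists a, [/\ supp f a, gcomp a b & y = gmul a b])).
move=> b [gb [a [fa ha]]]; have ab : gcomp a b by apply/gcompP.
exists (gmul a b); split; first by exists a.
move=> O oO Oab; have [A [B' [oA [oB' [Aa [B'b hAB]]]]]] := hG.1.1 O a b oO ab Oab.
exists (fun y => B' y /\ exists a', (A a' /\ supp f a') /\ grange y = gsource a').
split; [|split].
- apply: open_inter => //.
  apply: (grange_cont hG (V := fun y => exists a', (A a' /\ supp f a') /\ y = gsource a')).
  by apply: gsource_open => //; exact: open_inter.
- by split=> //; exists a.
- move=> u y [B'u [a' [[Aa' fa'] hu]]] _ [a'' [fa'' au ->]].
  have -> : a'' = a' by apply: bf.2 => //; rewrite -hu; apply/gcompP.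
  by apply: hAB => //; apply/gcompP.
Qed.

End Steinberg.

(** * Homogeneous normalisers of the diagonal *)

Section Normalisers.
Variables (G : groupoid) (R : idomainType) (Gam : groupType) (c : G -> Gam).
Hypothesis hG : ample_hausdorff G.
Hypothesis hc : cont_cocycle c.
Local Notation tau := (gtop G).
Implicit Types (f n m d : G -> R) (a b e x : G) (g : Gam).

(** Only the product and the diagonal occur, so a ring isomorphism preserving the diagonal
    transports this. The intermediate product [h1] is named and required to be in the algebra
    because convolution is a relation and is transported only there. *)
Definition half_normalising n m : Prop :=
  (exists p, diagonal p /\ conv m n p /\ conv n p n) /\
  forall d, diagonal d -> exists h1 h2, steinberg h1 /\ conv n d h1 /\ conv h1 m h2 /\ diagonal h2.

Definition normalising_pair g n m : Prop :=
  [/\ graded_comp c g n, graded_comp c (g^-1)%g m, half_normalising n m & half_normalising m n].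

(* The intrinsic notion of normaliser turns out to be equivalent to this
   pointwise one as soon as the group rings of the isotropy are well behaved. *)
Definition bisection_unit g n : Prop :=
  [/\ graded_comp c g n, bisection (supp n) & forall a, n a <> 0 -> n a \is a GRing.unit].

(* Compressing [d] to the indicator of a small neighbourhood of [x] isolates the
   terms with middle point [x] in the convolution [n d m]. *)
Lemma fsum_off_unit n m q x e : steinberg n -> half_normalising n m -> conv n m q ->
  unit_space x -> ~ unit_space e ->
  fsum (fun p => [/\ gcomp p.1 p.2, gmul p.1 p.2 = e & gsource p.1 = x])
       (fun p => n p.1 * m p.2) 0.
Proof.
move=> sn [_ hD] hq ux ne; have [l [_ [hl _]]] := hq e.
(* [l] lists the finitely many nonzero terms of [n m] at [e]; [W] excludes their middle points other
   than [x]. *)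
have [W [oW [Wx hW]]] := open_avoid_list (List.map (fun p => gsource p.1) l) x hG.2.1.
have [K [oK cK Kx sK]] := compact_open_unit hG oW Wx ux.
have dK : diagonal (ind R K) by apply: diagonal_ind => // y /sK[].
have [h1 [h2 [_ [c1 [c2 d2]]]]] := hD _ dK.
have e1 : h1 = mulD n (ind R K) by apply: (conv_unique c1); exact: conv_diag dK.2.
have z : h2 e = 0 by apply: contrapT => /d2.2.
move/conv_fsum: c2 => /(_ e); rewrite z e1.
have key p : gcomp p.1 p.2 -> gmul p.1 p.2 = e -> n p.1 * m p.2 <> 0 ->
    K (gsource p.1) -> gsource p.1 = x.
  move=> pc pe pn Kp; apply: contrapT => nx.
  apply: (hW (gsource p.1) _ nx); last by have [] := sK _ Kp.
  by apply: List.in_map; apply/hl.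
apply: fsum_ext => -[a b] /=; last first.
  by move=> _ /mulr_neq0P[/mulr_neq0P[_ /ind_supp Ka] _]; rewrite /mulD indT // mulr1.
split.
  move=> [[ab abe] /mulr_neq0P[/mulr_neq0P[na /ind_supp Ka] mb]].
  by split; [split=> //; apply: (key (a, b)) => //; apply/mulr_neq0P|apply/mulr_neq0P].
by move=> [[ab abe ax] nm]; split=> //; rewrite /mulD indT ?mulr1 // ax.
Qed.

Lemma unit_source_pt n p a : subset (supp p) (@unit_space G) -> conv n p n -> n a <> 0 ->
  p (gsource a) = 1.
Proof.
move=> sp cn na; have := conv_unique (conv_diag n sp) cn.
move=> /(congr1 (fun f => f a)); rewrite /mulD => e.
have /eqP nz : n a <> 0 by [].
by apply: (mulfI nz); rewrite mulr1.
Qed.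

(** * Translates of a normaliser in the isotropy group ring at a point *)

Section AtPoint.
Variables (g : Gam) (n m : G -> R) (x : G).
Hypothesis hn : graded_comp c g n.
Hypothesis hm : graded_comp c (g^-1)%g m.
Hypothesis hnm : half_normalising n m.
Variable q : G -> R.
Hypothesis hq : conv n m q.
Hypothesis hR :
  grring_nzd_trivial_units R (fun e => c e = @monoid.one Gam /\ isotropy x e) x.
Hypothesis ux : unit_space x.

Let H e := c e = @monoid.one Gam /\ isotropy x e.

(** [la a1] is [n] on the coset of [a1] by the isotropy group at [x], translated into that group;
    [rb b1] does the same for [m] on the other side. Homogeneity then places both supports in the
    degree-one subgroup [H]. *)
Let la a1 : G -> R := fun h => if `[< isotropy x h >] then n (gmul a1 h) else 0.
Let rb b1 : G -> R := fun h => if `[< isotropy x h >] then m (gmul h b1) else 0.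

Let laE a1 h : isotropy x h -> la a1 h = n (gmul a1 h).
Proof. by move=> i; rewrite /la; case: asboolP. Qed.

Let rbE b1 h : isotropy x h -> rb b1 h = m (gmul h b1).
Proof. by move=> i; rewrite /rb; case: asboolP. Qed.

Let la_iso a1 h : la a1 h <> 0 -> isotropy x h /\ n (gmul a1 h) <> 0.
Proof. by rewrite /la; case: asboolP. Qed.

Let rb_iso b1 h : rb b1 h <> 0 -> isotropy x h /\ m (gmul h b1) <> 0.
Proof. by rewrite /rb; case: asboolP. Qed.

Let isoM h h' : isotropy x h -> isotropy x h' -> gcomp h h' /\ isotropy x (gmul h h').
Proof.
move=> [sh rh] [sh' rh']; have hh : gcomp h h' by apply/gcompP; rewrite sh rh'.
by split=> //; split; rewrite ?gsourceM ?grangeM.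
Qed.

Let isox : isotropy x x.
Proof. by split; [exact: gsource_unit|exact: grange_unit]. Qed.

Let la_elt a1 : c a1 = g -> gsource a1 = x -> group_ring_elt H (la a1).
Proof.
move=> ca1 sa1; have [L hL] := steinberg_fiber hG x hn.1; split.
  exists (List.map (fun e => gmul (ginv a1) e) L) => h /la_iso[[sh rh] nh].
  have a1h : gcomp a1 h by apply/gcompP; rewrite sa1 rh.
  by apply/List.in_map_iff; exists (gmul a1 h); split; [exact: gmulKl|apply: hL; rewrite ?gsourceM].
move=> h /la_iso[[sh rh] nh]; split=> //.
have a1h : gcomp a1 h by apply/gcompP; rewrite sa1 rh.
apply: (@mulgI _ (c a1)); rewrite -(cocycleM hc a1h) mulg1.
by rewrite (hn.2 _ nh) ca1.
Qed.

Let rb_elt b1 : c b1 = (g^-1)%g -> grange b1 = x -> group_ring_elt H (rb b1).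
Proof.
(* Inversion turns the range fibre of [m] at [x] into a source fibre, to which [steinberg_fiber]
   applies. *)
move=> cb1 rb1; pose m' e := m (ginv e).
have sm' : steinberg m'.
  split; first by apply: lconst_comp hm.1.1; exact: (ginv_cont hG).
  rewrite (_ : supp m' = fun y => exists k, supp m k /\ y = ginv k).
    by apply: compact_image_fun hm.1.2 _; exact: hG.1.2.
  apply: eq_pred => y; split=> [h|[k [hk ->]]]; last by rewrite /supp /m' ginvK.
  by exists (ginv y); rewrite ginvK.
have [L hL] := steinberg_fiber hG x sm'; split.
  exists (List.map (fun e => gmul (ginv e) (ginv b1)) L) => h /rb_iso[[sh rh] mh].
  have hb1 : gcomp h b1 by apply/gcompP; rewrite sh rb1.
  apply/List.in_map_iff; exists (ginv (gmul h b1)); rewrite ginvK; split; first exact: gmulKr.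
  by apply: hL; rewrite /m' ?ginvK // gsourceV grangeM.
move=> h /rb_iso[[sh rh] mh]; split=> //.
have hb1 : gcomp h b1 by apply/gcompP; rewrite sh rb1.
apply: (@mulIg _ (c b1)); rewrite -(cocycleM hc hb1) mul1g.
by rewrite (hm.2 _ mh) cb1.
Qed.

(** The pairs [(h1, h2)] with product [h] correspond to the factorisations [(a1 h1, h2 b1)] of
    [a1 h b1] with middle point [x]; the sum over these is only a part of [n m]. *)
Let conv_la_rb a1 b1 (k : G -> R) : gsource a1 = x -> grange b1 = x ->
  (forall h, ~ isotropy x h -> k h = 0) ->
  (forall h, isotropy x h ->
     fsum (fun p => [/\ gcomp p.1 p.2, gmul p.1 p.2 = gmul (gmul a1 h) b1 & gsource p.1 = x])
       (fun p => n p.1 * m p.2) (k h)) ->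
  conv (la a1) (rb b1) k.
Proof.
move=> sa1 rb1 k0 kS; apply/conv_fsum => h.
have [ih|nih] := pselect (isotropy x h); last first.
  rewrite k0 //; apply: fsum0 => -[h1 h2] /= [_ e]; apply: contrapT => /mulr_neq0P[].
  by move=> /la_iso[i1 _] /rb_iso[i2 _]; apply: nih; rewrite -e; case: (isoM i1 i2).
have [sh rh] := ih; have a1h : gcomp a1 h by apply/gcompP; rewrite sa1 rh.
have ahb : gcomp (gmul a1 h) b1 by apply/gcompP; rewrite gsourceM // sh rb1.
apply: (fsum_bij (h := fun p => (gmul (ginv a1) p.1, gmul p.2 (ginv b1)))
  (k := fun p => (gmul a1 p.1, gmul p.2 b1))) (kS h ih).
- move=> [a b] /= [ab abe ax] _.
  have ra : grange a1 = grange a by rewrite -(grangeM ab) abe !grangeM.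
  have sb : gsource b = gsource b1 by rewrite -(gsourceM ab) abe gsourceM.
  have a1a : gcomp (ginv a1) a by apply/gcompP; rewrite gsourceV.
  have bb1 : gcomp b (ginv b1) by apply/gcompP; rewrite grangeV.
  have rb' : grange b = x by rewrite -ax; apply/esym/gcompP.
  have i1 : isotropy x (gmul (ginv a1) a).
    by split; rewrite ?gsourceM ?grangeM // grangeV.
  have i2 : isotropy x (gmul b (ginv b1)).
    by split; rewrite ?gsourceM ?grangeM // gsourceV.
  rewrite laE // rbE // gmulVK // gmulKV //; split=> //; split; first by have [] := isoM i1 i2.
  rewrite gmul_assoc //; last by apply: gcomp_assoc_r.
  rewrite -[gmul a _]gmul_assoc // abe gmulKr // gmulKl //.
- move=> [h1 h2] /= [h12 e] /mulr_neq0P[/la_iso[i1 n1] /rb_iso[i2 m2]].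
  have ah1 : gcomp a1 h1 by apply/gcompP; rewrite sa1 i1.2.
  have h2b : gcomp h2 b1 by apply/gcompP; rewrite i2.1 rb1.
  rewrite gmulKl // gmulKr //; split=> //; last by apply/mulr_neq0P.
  split; last by rewrite gsourceM // i1.1.
    by apply/gcompP; rewrite gsourceM // grangeM // i1.1 i2.2.
  rewrite -e gmul_assoc //; last by apply/gcompP; rewrite grangeM //; exact/gcompP.
  rewrite gmul_assoc //; first by congr (gmul a1 _); rewrite gmul_assoc.
    by apply/gcompP; rewrite grangeM // sa1 i1.2.
  by apply/gcompP; rewrite gsourceM // i2.1 rb1.
Qed.

(* Otherwise the product of the two translates in the group ring vanishes. *)
Let same_fiber a1 b1 : n a1 <> 0 -> gsource a1 = x -> m b1 <> 0 -> grange b1 = x ->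
  grange a1 = gsource b1.
Proof.
move=> na1 sa1 mb1 rb1; apply: contrapT => ne.
have cab : conv (la a1) (rb b1) (fun=> 0).
  apply: conv_la_rb => // h [sh rh].
  have a1h : gcomp a1 h by apply/gcompP; rewrite sa1 rh.
  have ahb : gcomp (gmul a1 h) b1 by apply/gcompP; rewrite gsourceM // sh rb1.
  (* A unit has equal range and source, whereas [a1 h b1] has the range of [a1] and the source of
     [b1]. *)
  apply: (fsum_off_unit hn.1 hnm hq ux) => u; apply: ne.
  rewrite -(grangeM a1h) -(grangeM ahb) -(gsourceM ahb).
  by rewrite grange_unit // gsource_unit.
have [h|h] := hR.1 _ _ _ (la_elt (hn.2 _ na1) sa1) (rb_elt (hm.2 _ mb1) rb1) cab (fun=> erefl).
  by apply: na1; have := h x; rewrite laE // -{1}sa1 gmul_source.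
by apply: mb1; have := h x; rewrite rbE // -{1}rb1 gmul_range.
Qed.

(** The translate [la a0] is invertible in the group ring with inverse [rb (ginv a0)]. It is
    therefore a trivial unit, supported at one point, and the fibre of [n] over [x] is a single
    point. *)
Lemma normaliser_fiber a0 : n a0 <> 0 -> gsource a0 = x ->
  (forall a, n a <> 0 -> gsource a = x -> a = a0) /\ n a0 * m (ginv a0) = 1.
Proof.
move=> na0 sa0; have [[p [[sp dp] [cp cn]]] _] := hnm.
have px : p x = 1 by rewrite -sa0; exact: unit_source_pt dp cn na0.
(* Since [m n] is nonzero at [x], there is a [b1] against which [same_fiber] compares all ranges in
   the fibre. *)
have /(conv_neq0 cp)[b1 [a1 [ba1 bax mb1 na1]]] : p x <> 0 by rewrite px; apply/eqP; rewrite oner_eq0.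
have rb1 : grange b1 = x by rewrite -(grangeM ba1) bax grange_unit.
have sa1 : gsource a1 = x by rewrite -(gsourceM ba1) bax gsource_unit.
have ran a : n a <> 0 -> gsource a = x -> grange a = gsource b1.
  by move=> na sa; exact: same_fiber.
have sou b : m b <> 0 -> grange b = x -> gsource b = grange a0.
  by move=> mb rb'; rewrite (same_fiber na0 sa0 mb rb').
pose b0 := ginv a0.
have rb0 : grange b0 = x by rewrite grangeV.
have a0b0 : gcomp a0 b0 by exact: gcomp_inv.
have b0a0 : gcomp b0 a0 by exact: gcompVl.
pose delta h : R := if `[< h = x >] then 1 else 0.
have deltaP : is_delta x 1 delta.
  by split=> [|e ne]; rewrite /delta; case: asboolP.
(* On the isotropy group this product is [m n], that is [p]: it lives on units, and [x] is the only
   unit there. By [sou] every middle point is the range of [a0], so [(b, a)] may be translated to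
   [(b a0, a0^-1 a)]. *)
have cba : conv (rb b0) (la a0) delta.
  apply/conv_fsum => h.
  have [ih|nih] := pselect (isotropy x h); last first.
    rewrite deltaP.2; last by move=> e; apply: nih; rewrite e.
    apply: fsum0 => -[h1 h2] /= [_ e]; apply: contrapT => /mulr_neq0P[].
    by move=> /rb_iso[i1 _] /la_iso[i2 _]; apply: nih; rewrite -e; case: (isoM i1 i2).
  have -> : delta h = p h.
    have [->|ne] := pselect (h = x); first by rewrite px deltaP.1.
    rewrite deltaP.2 //; apply/esym; apply: contrapT => /dp uh; apply: ne.
    by rewrite -(grange_unit uh) ih.2.
  move/conv_fsum: cp => /(_ h).
  apply: (fsum_bij (h := fun p => (gmul p.1 a0, gmul b0 p.2))
    (k := fun p => (gmul p.1 b0, gmul a0 p.2))).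
  - move=> [b a] /= [ba e] /mulr_neq0P[mb na].
    have rb' : grange b = x by rewrite -(grangeM ba) e ih.2.
    have sa : gsource a = x by rewrite -(gsourceM ba) e ih.1.
    have sb := sou _ mb rb'.
    have ra : grange a = grange a0 by rewrite -sb; apply/esym/gcompP.
    have ba0 : gcomp b a0 by apply/gcompP.
    have b0a : gcomp b0 a by apply/gcompP; rewrite gsourceV.
    have i1 : isotropy x (gmul b a0) by split; rewrite ?gsourceM ?grangeM.
    have i2 : isotropy x (gmul b0 a) by split; rewrite ?gsourceM ?grangeM.
    rewrite laE // rbE // gmulVK // gmulKr //; split=> //; split; first by case: (isoM i1 i2).
    rewrite gmul_assoc //; last by apply/gcompP; rewrite grangeM // sa0.
    by rewrite gmulVK.
  - move=> [h1 h2] /= [h12 e] /mulr_neq0P[/rb_iso[i1 m1] /la_iso[i2 n2]].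
    have h1b : gcomp h1 b0 by apply/gcompP; rewrite i1.1 rb0.
    have ah2 : gcomp a0 h2 by apply/gcompP; rewrite sa0 i2.2.
    have bah : gcomp b0 (gmul a0 h2) by apply: gcomp_assoc_r.
    split; last 1 first.
    + by rewrite gmulKV ?gmulKl // i1.1 sa0.
    + split; first by apply/gcompP; rewrite gsourceM // grangeM // gsourceV.
      by rewrite gmul_assoc // gmulKl.
    + by apply/mulr_neq0P.
(* For [h] other than [x] the element [a0 h a0^-1] is not a unit, and [fsum_off_unit] annihilates
   the sum. *)
have cab : conv (la a0) (rb b0) delta.
  apply: conv_la_rb => // [h nih|h ih].
    by rewrite deltaP.2 // => e; apply: nih; rewrite e.
  have [sh rh] := ih; have ah : gcomp a0 h by apply/gcompP; rewrite sa0 rh.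
  have hb : gcomp h b0 by apply/gcompP; rewrite sh rb0.
  have ahb : gcomp (gmul a0 h) b0 by apply/gcompP; rewrite gsourceM // sh rb0.
  have [e|ne] := pselect (h = x); last first.
    rewrite deltaP.2 //; apply: (fsum_off_unit hn.1 hnm hq ux) => u; apply: ne.
    have ab : gmul a0 h = a0.
      rewrite -(ginvK (gmul a0 h)) -[RHS]ginvK; congr ginv.
      by rewrite -(ginv_unique ahb u).
    by rewrite -(gmulKl ah) ab -[LHS]/(gsource a0) sa0.
  subst h; rewrite deltaP.1.
  have -> : gmul (gmul a0 x) b0 = grange a0 by rewrite -sa0 gmul_source.
  (* [n m] at the range of [a0] and [m n] at its source have the same terms, swapped. *)
  move/conv_fsum: cp => /(_ x); rewrite px.
  apply: (fsum_bij (h := fun p => (p.2, p.1)) (k := fun p => (p.2, p.1))).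
  - move=> [b a] /= [ba e] /mulr_neq0P[mb na]; split=> //; last by rewrite mulrC.
    have rb' : grange b = x by rewrite -(grangeM ba) e grange_unit.
    have sa : gsource a = x by rewrite -(gsourceM ba) e gsource_unit.
    have ea : a = ginv b by apply: ginv_unique => //; rewrite e.
    have ab : gcomp a b by apply/gcompP; rewrite sa rb'.
    by split=> //; rewrite -(sou _ mb rb') ea.
  - move=> [a b] /= [ab e sa] /mulr_neq0P[na mb]; split=> //; last by rewrite mulrC; apply/mulr_neq0P.
    have eb : b = ginv a by apply: ginv_unique => //; rewrite e; exact: unit_range.
    by rewrite eb; split; [exact: gcompVl|exact: sa].
have Hb0 : exists k : G -> R, group_ring_elt H k /\
        (exists h, conv (la a0) k h /\ is_delta x 1 h) /\
        (exists h, conv k (la a0) h /\ is_delta x 1 h).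
  exists (rb b0); split; last by split; exists delta.
  by apply: rb_elt => //; rewrite cocycleV // (hn.2 _ na0).
have [u [h0 [_ [_ hu]]]] := hR.2 _ (la_elt (hn.2 _ na0) sa0) Hb0.
(* The support point [h0] must be [x], where [la a0] takes the nonzero value [n a0]. *)
have lx h : la a0 h <> 0 -> h = x.
  move=> lh; have lxx : la a0 x <> 0 by rewrite laE // -{1}sa0 gmul_source.
  transitivity h0; first by apply: contrapT => /hu.
  by apply: contrapT => ne; apply: lxx; apply: hu => e; apply: ne.
(* By [ran] each [a] in the fibre has the range of [a0], hence is a translate of [a0] by the
   isotropy element [a0^-1 a]. *)
have uniq_a a : n a <> 0 -> gsource a = x -> a = a0.
  move=> na sa; have ra : grange a0 = grange a by rewrite (ran a) // (ran a0).
  have b0a : gcomp b0 a by apply/gcompP; rewrite gsourceV.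
  have i : isotropy x (gmul b0 a) by split; rewrite ?gsourceM ?grangeM.
  have e : gmul b0 a = x by apply: lx; rewrite laE // gmulVK.
  by rewrite -(gmulVK ra) -/b0 e -sa0 gmul_source.
(* With a single point in the fibre, the sum for [p x = 1] reduces to the term at [(b0, a0)]. *)
split=> //; have ea := uniq_a _ na1 sa1.
rewrite mulrC -px; apply: fsum_unique; last exact: (conv_fsum _ _ _).1 cp x.
apply: (@fsum1 _ _ _ (fun p => m p.1 * n p.2) (b0, a0)) => /=; first by split.
move=> [b a] /= [ba e] /mulr_neq0P[mb na].
have sa : gsource a = x by rewrite -(gsourceM ba) e gsource_unit.
have e0 := uniq_a _ na sa; subst a; congr pair.
by rewrite -(ginvK b) -(ginv_unique ba) // e.
Qed.

End AtPoint.
End Normalisers.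

(** * Normalisers as unit-valued functions on bisections *)

Section BisectionUnits.
Variables (G : groupoid) (R : idomainType) (Gam : groupType) (c : G -> Gam).
Hypothesis hG : ample_hausdorff G.
Hypothesis hc : cont_cocycle c.
Local Notation tau := (gtop G).
Implicit Types (f n m d : G -> R) (a b e x : G) (g : Gam).

Section Dense.
Variable X : G -> Prop.
Hypothesis hX : dense_in_unit_space X.
Hypothesis hR : forall x, X x ->
  grring_nzd_trivial_units R (fun e => c e = @monoid.one Gam /\ isotropy x e) x.

(** Each failure spreads over an open set of units: the common source images of two disjoint
    neighbourhoods, or the sources where [n a * m (ginv a)] differs from 1. Such a set meets [X],
    where [normaliser_fiber] forbids it. *)
Lemma normalising_pair_source g n m : normalising_pair c g n m ->
  inj_on (supp n) (@gsource G) /\ forall a, n a <> 0 -> n a * m (ginv a) = 1.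
Proof.
move=> [gn gm hnm [[q [_ [hq _]]] _]].
have on : is_open tau (supp n) by exact: (lconst_level (fun r => r <> 0) gn.1.1).
have fib x a (Xx : X x) := normaliser_fiber hG hc gn gm hnm hq (hR Xx) (hX.1 x Xx) (a0 := a).
split=> [a b na nb ab|a na].
  apply: contrapT => ne; have [U [V [oU [oV [Ua [Vb d]]]]]] := hG.2.1 _ _ ne.
  have [] := hX.2 (fun y => (exists v, (U v /\ supp n v) /\ y = gsource v) /\
                          (exists v, (V v /\ supp n v) /\ y = gsource v)).
  - by apply: open_inter; apply: gsource_open => //; exact: open_inter.
  - exists (gsource a); split; last exact: unit_source.
    by split; [exists a|exists b].
  - move=> x [[[u [[Uu nu] xu]] [v [[Vv nv] xv]]] Xx].
    have [h _] := fib _ _ Xx nu (esym xu).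
    by apply: (d v); rewrite {1}(h v nv).
apply: contrapT => ne.
have [] := hX.2 (fun y => exists v, (supp n v /\ n v * m (ginv v) <> 1) /\ y = gsource v).
- apply: gsource_open => //; apply: open_inter => //.
  apply: (lconst_level (f := fun v => n v * m (ginv v)) (fun r => r <> 1)).
  apply: (lconst_op2 (fun r s => r * s) gn.1.1).
  exact: lconst_comp (ginv_cont hG) gm.1.1.
- by exists (gsource a); split; [exists a|exact: unit_source].
- move=> x [[v [[nv nev] xv]] Xx]; apply: nev.
  by have [_] := fib _ _ Xx nv (esym xv).
Qed.

(** The notion is symmetric in [n] and [m] up to inverting the degree. Inverses of points of
    [supp n] lie in [supp m], so injectivity of the range on [supp n] follows from that of the
    source on [supp m]. *)
Lemma normalising_pair_bisection g n m :
  normalising_pair c g n m -> bisection_unit c g n.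
Proof.
move=> hp; have [gn gm h1 h2] := hp.
have [inj_n inv_n] := normalising_pair_source hp.
have [inj_m _] : inj_on (supp m) (@gsource G) /\ forall a, m a <> 0 -> m a * n (ginv a) = 1.
  by apply: (@normalising_pair_source (g^-1)%g); split=> //; rewrite invgK.
have nm a : n a <> 0 -> m (ginv a) <> 0.
  by move=> na z; have := inv_n a na; rewrite z mulr0 => /esym/eqP; rewrite oner_eq0.
split=> //; last by move=> a na; apply/unitrPr; exists (m (ginv a)); exact: inv_n.
split=> // a b na nb ab; rewrite -(ginvK a) -(ginvK b); congr ginv.
by apply: inj_m; [exact: nm|exact: nm|rewrite !gsourceV].
Qed.

End Dense.

(** The ring inverse fixes non-units, in particular 0, so the support is just inverted and applying
    the operation twice gives [n] back for every [n]. *)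
Definition inverse_unit n : G -> R := fun e => (n (ginv e))^-1.

Lemma inverse_unitK n : inverse_unit (inverse_unit n) = n.
Proof. by apply: funext => e; rewrite /inverse_unit ginvK invrK. Qed.

Lemma inverse_unit_neq0 n e : inverse_unit n e <> 0 <-> n (ginv e) <> 0.
Proof.
rewrite /inverse_unit; split=> /eqP; first by rewrite invr_eq0 => /eqP.
by move=> h; apply/eqP; rewrite invr_eq0.
Qed.

Lemma inverse_unit_bisection g n :
  bisection_unit c g n -> bisection_unit c (g^-1)%g (inverse_unit n).
Proof.
move=> [[sn gn] [bs br] un]; split.
- split; last by move=> e /inverse_unit_neq0/gn; rewrite cocycleV // => <-; rewrite invgK.
  split.
    have ln := lconst_comp (ginv_cont hG) sn.1.
    exact: (lconst_op2 (fun r _ => r^-1) ln ln).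
  rewrite (_ : supp _ = fun y => exists k, supp n k /\ y = ginv k).
    by apply: compact_image_fun sn.2 _; exact: hG.1.2.
  apply: eq_pred => y; split=> [/inverse_unit_neq0 h|[k [hk ->]]].
    by exists (ginv y); rewrite ginvK.
  by apply/inverse_unit_neq0; rewrite ginvK.
- split=> a b /inverse_unit_neq0 na /inverse_unit_neq0 nb ab;
    rewrite -(ginvK a) -(ginvK b); congr ginv.
    by apply: br => //; rewrite !gsourceV.
  by apply: bs => //; rewrite !grangeV.
- by move=> a /inverse_unit_neq0 na; rewrite unitrV; exact: un.
Qed.

(** In a nonzero term of [m n] or [n d m] the two factors are mutually inverse, because [supp n] is
    a bisection; so these products live on units, and [m n] is 1 at the sources of [supp n]. *)
Lemma bisection_half_normalising g n :
  bisection_unit c g n -> half_normalising n (inverse_unit n).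
Proof.
move=> hn; have [[sm gm] bm um] := inverse_unit_bisection hn.
have [[sn gn] bn un] := hn; set m := inverse_unit n in sm gm bm um *.
split.
  have [p [sp cp]] := conv_bisection hG sm bm sn.
  have dp : diagonal p.
    split=> // e /(conv_neq0 cp)[b [a [ba <- /inverse_unit_neq0 nb na]]].
    have -> : a = ginv b by apply: bn.1 => //; rewrite grangeV; apply/esym/gcompP.
    exact: unit_range.
  exists p; split=> //; split=> //.
  have := conv_diag n dp.2; have -> // : mulD n p = n.
  apply: funext => a; rewrite /mulD; have [->|/eqP na] := eqVneq (n a) 0; first by rewrite mul0r.
  rewrite /gsource (conv_eval bm.1 cp) //; last exact: gcompVl.
    by rewrite /m /inverse_unit ginvK mulVr ?mulr1 //; exact: un.
  by apply/inverse_unit_neq0; rewrite ginvK.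
move=> d dd; have sh1 : steinberg (mulD n d) by exact: steinberg_mulD.
have bh1 : bisection (supp (mulD n d)) by apply: bisection_sub bn => e /mulr_neq0P[].
have [h2 [sh2 ch2]] := conv_bisection hG sh1 bh1 sm.
exists (mulD n d), h2; split=> //; split; first exact: conv_diag dd.2.
split=> //; split=> // e /(conv_neq0 ch2)[a [b [ab <- /mulr_neq0P[na _] /inverse_unit_neq0 nb]]].
have -> : a = ginv b by apply: bn.2 => //; rewrite gsourceV; apply/gcompP.
exact: unit_source.
Qed.

Lemma bisection_normalising_pair g n :
  bisection_unit c g n -> normalising_pair c g n (inverse_unit n).
Proof.
move=> hn; have hm := inverse_unit_bisection hn.
split; [by case: hn|by case: hm|exact: bisection_half_normalising hn|].
by have := bisection_half_normalising hm; rewrite inverse_unitK.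
Qed.

(** * Cutting by idempotents of the diagonal *)

Definition idempotent_fun d : Prop := forall e, d e * d e = d e.

Lemma idempotent_fun01 d e : idempotent_fun d -> d e = 0 \/ d e = 1.
Proof.
move=> /(_ e) h; have [|/eqP nz] := pselect (d e = 0); first by left.
by right; apply: (mulfI nz); rewrite h mulr1.
Qed.

(** Restates pointwise idempotence as an identity in the algebra, which a ring isomorphism can
    carry. *)
Lemma idempotent_mulD d : diagonal d -> (idempotent_fun d <-> mulD d d = d).
Proof.
move=> [_ dd]; have E : mulD d d = fun e => d e * d e.
  apply: funext => e; rewrite /mulD; have [z|/eqP/dd ue] := eqVneq (d e) 0.
    by rewrite z !mul0r.
  by rewrite gsource_unit.
by rewrite E; split=> [h|h e]; [apply: funext|rewrite -[RHS](congr1 (fun f => f e) h)].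
Qed.

Lemma idempotent_ind (K : G -> Prop) : idempotent_fun (ind R K).
Proof. by move=> e; rewrite /ind; case: asboolP; rewrite ?mulr1 ?mulr0. Qed.

Lemma bisection_unit_restrict g n (f : G -> R) : bisection_unit c g n -> steinberg f ->
  (forall e, f e = 0 \/ f e = n e) -> bisection_unit c g f.
Proof.
move=> [[sn gn] bn un] sf fn.
have E e : f e <> 0 -> f e = n e by case: (fn e).
split=> [||a fa].
- by split=> // e fe; apply: gn; rewrite /supp -E.
- by apply: bisection_sub bn => e fe; rewrite /supp -E.
- by rewrite E //; apply: un; rewrite -E.
Qed.

Lemma bisection_unit_mulD g n d : bisection_unit c g n -> diagonal d -> idempotent_fun d ->
  bisection_unit c g (mulD n d).
Proof.
move=> hn dd id; have [[sn _] _ _] := hn.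
apply: (bisection_unit_restrict hn); first exact: steinberg_mulD.
move=> e; rewrite /mulD; case: (idempotent_fun01 (gsource e) id) => ->.
  by left; rewrite mulr0.
by right; rewrite mulr1.
Qed.

Lemma bisection_unit_mulCD g n d : bisection_unit c g n -> diagonal d -> idempotent_fun d ->
  bisection_unit c g (mulCD n d).
Proof.
move=> hn dd id; have [[sn _] _ _] := hn.
apply: (bisection_unit_restrict hn); first exact: steinberg_mulCD.
move=> e; rewrite /mulCD; case: (idempotent_fun01 (gsource e) id) => ->.
  by right; rewrite subr0 mulr1.
by left; rewrite subrr mulr0.
Qed.

(** Both functions are constant near [a]. Cut to a small set [K] of sources they have the same
    support, and the scalar [n a / n' a] in [d'] reconciles their values. This says algebraically
    that the supports meet at [a]. *)
Lemma bisection_unit_agree g g' n n' a :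
  bisection_unit c g n -> bisection_unit c g' n' -> n a <> 0 -> n' a <> 0 ->
  exists d d', [/\ diagonal d, idempotent_fun d, d (gsource a) = 1, diagonal d'
    & mulD n d = mulD n' d'].
Proof.
move=> [[sn _] bn un] [[sn' _] bn' un'] na na'.
pose O e := n e = n a /\ n' e = n' a.
have oO : is_open tau O.
  apply: open_inter; first exact: (lconst_level (fun r => r = n a) sn.1).
  exact: (lconst_level (fun r => r = n' a) sn'.1).
have os : is_open tau (supp n) by exact: (lconst_level (fun r => r <> 0) sn.1).
have os' : is_open tau (supp n') by exact: (lconst_level (fun r => r <> 0) sn'.1).
have [W [oW Wa hW]] := shrink_source hG os bn.2 oO na (conj erefl erefl).
have [W' [oW' Wa' hW']] := shrink_source hG os' bn'.2 oO na' (conj erefl erefl).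
have [K [oK cK Ka sK]] := compact_open_unit hG (open_inter oW oW') (conj Wa Wa') (unit_source a).
have dK : diagonal (ind R K) by apply: diagonal_ind => // y /sK[].
exists (ind R K), (fun e => ind R K e * (n a / n' a)); split=> //.
- exact: idempotent_ind.
- exact: indT.
- split; last by move=> e /mulr_neq0P[/dK.2].
  apply: steinberg_mul dK.1 _ => e; exists (fun=> True); split=> //; exact: open_full.
- apply: funext => e; rewrite /mulD; have [Ke|nK] := pselect (K (gsource e)); last first.
    by rewrite indF // mul0r !mulr0.
  rewrite indT // mulr1 mul1r; have [[We We'] _] := sK _ Ke.
  have [z|/eqP ne] := eqVneq (n e) 0.
    have [->|/eqP ne'] := eqVneq (n' e) 0; first by rewrite z mul0r.
    by have [e1 _] := hW' _ ne' We'; case: na; rewrite -e1.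
  by have [-> ->] := hW _ ne We; rewrite mulrC divrK //; exact: un'.
Qed.

End BisectionUnits.

(** * Recovering a space from a common index set of compact open sets *)

Section Duality.
Variable I : Type.

Definition splits (T : Type) (U : I -> T -> Prop) (i j i1 i2 : I) : Prop :=
  [/\ subset (U i) (fun x => U i1 x \/ U i2 x), forall x, U i1 x -> ~ U i2 x,
      subset (U i1) (U i) & subset (U i1) (U j)].

(** The same [i1] and [i2] serve both families: [i1] carries membership in an intersection across,
    and the disjoint piece [i2] carries non-membership. *)
Definition splitting (T1 T2 : Type) (U : I -> T1 -> Prop) (V : I -> T2 -> Prop) : Prop :=
  forall i j x, U i x -> U j x -> exists i1 i2, [/\ U i1 x, splits U i j i1 i2 & splits V i j i1 i2].

(** The sets [V i] with [x] in [U i] are compact, closed and nonempty, and directed by splitting;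
    their common point is [y]. *)
Lemma duality_point (T1 T2 : Type) (tau2 : topology T2) (U : I -> T1 -> Prop)
    (V : I -> T2 -> Prop) (x : T1) :
  (forall i, compact tau2 (V i)) -> (forall i, is_open tau2 (fun y => ~ V i y)) ->
  (forall i x, U i x -> exists y, V i y) -> splitting U V -> splitting V U ->
  (exists i, U i x) -> exists y, forall i, U i x <-> V i y.
Proof.
move=> cV oV ne sUV sVU [i0 Ui0].
have [||||y hy] := @compact_directed _ tau2 {i | U i x} (exist _ i0 Ui0) (fun i => V (sval i)).
- by move=> i; exact: cV.
- by move=> i; exact: oV.
- by move=> [i Ui]; exact: ne Ui.
- move=> [i Ui] [j Uj]; have [i1 [i2 [Ui1 _ [_ _ s1 s2]]]] := sUV _ _ _ Ui Uj.
  by exists (exist _ i1 Ui1) => z Vz; split; [exact: s1|exact: s2].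
have fwd i : U i x -> V i y by move=> Ui; exact: (hy (exist _ i Ui)).
exists y => i; split=> [|Vi]; first exact: fwd.
(* [V i0] is split along [V i] at [y]. Were [x] in [U i2], then [y] would lie in [V i2], which is
   disjoint from [V i1]. *)
have [i1 [i2 [Vi1 [_ dV _ _] [cU _ _ sU]]]] := sVU _ _ _ (fwd _ Ui0) Vi.
by case: (cU _ Ui0) => [/sU//|/fwd Vi2]; case: (dV y).
Qed.

Lemma hausdorff_basis_sep (T : Type) (tau : topology T) (U : I -> T -> Prop) : hausdorff tau ->
  (forall O x, is_open tau O -> O x -> exists i, U i x /\ subset (U i) O) ->
  forall x y, (forall i, U i x -> U i y) -> y = x.
Proof.
move=> hT bU x y h; apply: contrapT => nyx; have [A [B [oA [oB [Ay [Bx d]]]]]] := hT _ _ nyx.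
by have [i [Ui sU]] := bU _ _ oB Bx; apply: (d y); split=> //; apply/sU/h.
Qed.

(** The two pointwise correspondences are mutually inverse because basic sets separate points, and
    continuous because they match basic sets with basic sets. *)
Lemma duality (T1 T2 : Type) (tau1 : topology T1) (tau2 : topology T2)
    (U : I -> T1 -> Prop) (V : I -> T2 -> Prop) :
  hausdorff tau1 -> hausdorff tau2 ->
  (forall i, is_open tau1 (U i)) -> (forall i, is_open tau2 (V i)) ->
  (forall i, compact tau1 (U i)) -> (forall i, compact tau2 (V i)) ->
  (forall O x, is_open tau1 O -> O x -> exists i, U i x /\ subset (U i) O) ->
  (forall O y, is_open tau2 O -> O y -> exists i, V i y /\ subset (V i) O) ->
  (forall i, (exists x, U i x) <-> (exists y, V i y)) ->
  splitting U V -> splitting V U ->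
  exists psi : T1 -> T2, exists phi : T2 -> T1, [/\ cancel psi phi, cancel phi psi,
    continuous tau1 tau2 psi, continuous tau2 tau1 phi & forall i x, U i x <-> V i (psi x)].
Proof.
move=> h1 h2 oU oV cU cV bU bV ne sUV sVU.
have [psi hpsi] : exists psi, forall x i, U i x <-> V i (psi x).
  have [|psi hpsi] := @choice T1 T2 (fun x y => forall i, U i x <-> V i y); last by exists psi.
  move=> x; apply: (duality_point (tau2 := tau2)) => //.
  - by move=> i; exact: compact_closed.
  - by move=> i z Uz; apply/ne; exists z.
  - by have [i [Ui _]] := bU _ x (open_full tau1) Logic.I; exists i.
have [phi hphi] : exists phi, forall y i, V i y <-> U i (phi y).
  have [|phi hphi] := @choice T2 T1 (fun y x => forall i, V i y <-> U i x); last by exists phi.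
  move=> y; apply: (duality_point (tau2 := tau1)) => //.
  - by move=> i; exact: compact_closed.
  - by move=> i z Vz; apply/ne; exists z.
  - by have [i [Vi _]] := bV _ y (open_full tau2) Logic.I; exists i.
have sep1 := hausdorff_basis_sep h1 bU; have sep2 := hausdorff_basis_sep h2 bV.
exists psi, phi; split=> //.
- by move=> x; apply: sep1 => i /hpsi/hphi.
- by move=> y; apply: sep2 => i /hphi/hpsi.
- move=> O oO; apply: open_local => x Ox; have [i [Vi sV]] := bV _ _ oO Ox.
  by exists (U i); split=> //; split; [apply/hpsi|move=> z /hpsi/sV].
- move=> O oO; apply: open_local => y Oy; have [i [Ui sU]] := bU _ _ oO Oy.
  by exists (V i); split=> //; split; [apply/hphi|move=> z /hphi/sU].
Qed.

End Duality.

(** * Groupoid homomorphisms *)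

Section Homomorphisms.
Variables (G1 G2 : groupoid) (psi : G1 -> G2).
Hypothesis hpsi : forall a b, gcomp a b ->
  gcomp (psi a) (psi b) /\ psi (gmul a b) = gmul (psi a) (psi b).

Lemma hom_unit x : unit_space x -> unit_space (psi x).
Proof.
move=> /unit_idem[xx e]; have [pxx pe] := hpsi xx.
by apply: (unit_idempotent pxx); rewrite -pe e.
Qed.

Lemma hom_source a : psi (gsource a) = gsource (psi a).
Proof.
have us := hom_unit (unit_source a).
have ab : gcomp a (gsource a) by apply/gcompP; rewrite grange_unit //; exact: unit_source.
by have [/gcompP -> _] := hpsi ab; rewrite grange_unit.
Qed.

Lemma hom_range a : psi (grange a) = grange (psi a).
Proof.
have us := hom_unit (unit_range a).
have ab : gcomp (grange a) a by apply/gcompP; rewrite gsource_unit //; exact: unit_range.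
by have [/gcompP <- _] := hpsi ab; rewrite gsource_unit.
Qed.

Lemma hom_inv a : psi (ginv a) = ginv (psi a).
Proof.
have [h e] := hpsi (gcomp_inv a); apply: ginv_unique => //.
by rewrite -e; exact/hom_unit/unit_range.
Qed.

Lemma injective_hom_comp a b : injective psi -> gcomp (psi a) (psi b) -> gcomp a b.
Proof. by move=> inj /gcompP; rewrite -hom_source -hom_range => /inj/gcompP. Qed.

End Homomorphisms.

(** * Algebra isomorphisms induced by groupoid isomorphisms *)

Section InducedIso.
Variables (G1 G2 : groupoid) (R : idomainType).

Lemma steinberg_comp (k : G2 -> G1) (k' : G1 -> G2) (f : G1 -> R) :
  cancel k k' -> cancel k' k ->
  continuous (gtop G2) (gtop G1) k -> continuous (gtop G1) (gtop G2) k' ->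
  steinberg f -> steinberg (fun e => f (k e)).
Proof.
move=> kK k'K ck ck' [lf cf]; split.
  move=> e; have [U [oU [Ue hU]]] := lf (k e).
  by exists (fun y => U (k y)); split; [exact: ck|split=> // y /hU].
rewrite (_ : supp _ = fun y => exists x, supp f x /\ y = k' x).
  exact: compact_image_fun cf ck'.
by apply: eq_pred => y; split=> [fy|[x [fx ->]]]; [exists (k y); rewrite kK|rewrite /supp k'K].
Qed.

Lemma conv_comp (k : G2 -> G1) (k' : G1 -> G2) (f g h : G1 -> R) :
  cancel k k' -> cancel k' k ->
  (forall a b, gcomp a b <-> gcomp (k a) (k b)) ->
  (forall a b, gcomp a b -> k (gmul a b) = gmul (k a) (k b)) ->
  conv f g h -> conv (fun e => f (k e)) (fun e => g (k e)) (fun e => h (k e)).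
Proof.
move=> kK k'K kc km /conv_fsum H; apply/conv_fsum => e.
apply: (fsum_bij (h := fun p => (k' p.1, k' p.2)) (k := fun p => (k p.1, k p.2))) (H (k e)).
  move=> [a b] /= [ab abe] _; rewrite !k'K; split=> //.
  have ab' : gcomp (k' a) (k' b) by apply/kc; rewrite !k'K.
  by split=> //; rewrite -[RHS]kK -abe -{2}(k'K a) -{2}(k'K b) -km // kK.
move=> [a b] /= [ab abe] fg; rewrite !kK; split=> //.
by split; [apply/kc|rewrite -km // abe].
Qed.

Lemma groupoid_iso_inv (psi : G1 -> G2) (k : G2 -> G1) :
  groupoid_iso psi -> cancel psi k -> cancel k psi ->
  [/\ continuous (gtop G2) (gtop G1) k, forall a b, gcomp a b <-> gcomp (k a) (k b)
    & forall a b, gcomp a b -> k (gmul a b) = gmul (k a) (k b)].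
Proof.
move=> [[k' [psiK [k'K ck']]] [_ [pc pm]]] kK k'K'.
have -> : k = k' by apply: funext => y; rewrite -(k'K y) kK psiK.
have kc a b : gcomp a b <-> gcomp (k' a) (k' b) by rewrite [X in _ <-> X]pc !k'K.
by split=> // a b ab; rewrite -{1}(k'K a) -{1}(k'K b) -pm ?psiK //; apply/kc.
Qed.

End InducedIso.

Lemma groupoid_iso_algebra (G1 G2 : groupoid) (R : idomainType) (star : R -> R) (Gam : groupType) (c1 : G1 -> Gam) (c2 : G2 -> Gam)
    (psi : G1 -> G2) :
  groupoid_iso psi -> (forall e, c2 (psi e) = c1 e) ->
  exists phi : (G1 -> R) -> (G2 -> R),
    star_alg_iso star phi /\ diagonal_preserving phi /\ graded c1 c2 phi.
Proof.
move=> iso pc; have [[k [psiK [kK ck]]] [cpsi [pcomp pm]]] := iso.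
have [_ kcomp km] := groupoid_iso_inv iso psiK kK.
have homk a b : gcomp a b -> gcomp (k a) (k b) /\ k (gmul a b) = gmul (k a) (k b).
  by move=> ab; split; [apply/kcomp|exact: km].
have homp a b : gcomp a b -> gcomp (psi a) (psi b) /\ psi (gmul a b) = gmul (psi a) (psi b).
  by move=> ab; split; [apply/pcomp|exact: pm].
have st1 f : steinberg f -> steinberg (fun e => f (k e) : R) by exact: steinberg_comp kK psiK ck cpsi.
have st2 f : steinberg f -> steinberg (fun e => f (psi e) : R) by exact: steinberg_comp psiK kK cpsi ck.
have psik (f : G2 -> R) : (fun e => f (psi (k e))) = f by apply: funext => e; rewrite kK.
have ck1 e : c1 (k e) = c2 e by rewrite -pc kK.
exists (fun f e => f (k e)); split; [split; [|split]|split].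
- split=> //; split; [|split; [|split]] => //.
  + move=> f g _ _ e; apply: funext => x; rewrite -(psiK x).
    exact: (congr1 (fun f => f (psi x)) e).
  + by move=> f sf; exists (fun e => f (psi e)); split; [exact: st2|exact: psik].
  + by move=> f g h _ _ _; exact: conv_comp psiK kcomp km.
- by [].
- by move=> f _; apply: funext => e; rewrite /gstar (hom_inv homk).
- split=> f [sf df].
    by split=> [|e fe]; [exact: st1|rewrite -(kK e); apply: hom_unit homp _ (df _ fe)].
  exists (fun e => f (psi e)); split; last exact: psik.
  split=> [|e fe]; first exact: st2.
  by rewrite -(psiK e); apply: hom_unit homk _ (df _ fe).
- move=> g; split=> f [sf gf].
    by split=> [|e fe]; [exact: st1|rewrite -ck1; exact: gf fe].
  exists (fun e => f (psi e)); split; last exact: psik.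
  by split=> [|e fe]; [exact: st2|rewrite -pc; exact: gf fe].
Qed.

(** * Reconstruction of the groupoid *)

Section Reconstruction.
Variables (R : idomainType) (Gam : groupType) (G1 G2 : groupoid).
Variables (c1 : G1 -> Gam) (c2 : G2 -> Gam) (X2 : G2 -> Prop).
Hypothesis hG1 : ample_hausdorff G1.
Hypothesis hG2 : ample_hausdorff G2.
Hypothesis hc1 : cont_cocycle c1.
Hypothesis hc2 : cont_cocycle c2.
Hypothesis hX2 : dense_in_unit_space X2.
Hypothesis hR2 : forall x, X2 x ->
  grring_nzd_trivial_units R (fun e => c2 e = @monoid.one Gam /\ isotropy x e) x.
Variable phi : (G1 -> R) -> (G2 -> R).
Hypothesis hphi : ring_iso phi.
Hypothesis hD : diagonal_preserving phi.
Hypothesis hgr : graded c1 c2 phi.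
Implicit Types (f n m d : G1 -> R) (g : Gam).

Let phiS f : steinberg f -> steinberg (phi f) := hphi.1 f.

Let phiD f f' : steinberg f -> steinberg f' ->
  phi (fun e => f e + f' e) = (fun e => phi f e + phi f' e) := hphi.2.2.2.1 f f'.

Let phiM f f' h : steinberg f -> steinberg f' -> steinberg h -> conv f f' h ->
  conv (phi f) (phi f') (phi h) := hphi.2.2.2.2 f f' h.

Let phi_inj f f' : steinberg f -> steinberg f' -> phi f = phi f' -> f = f' := hphi.2.1 f f'.

Let phi0 : phi (fun=> 0) = fun=> 0.
Proof.
have s0 := @steinberg0 G1 R; have := phiD s0 s0.
rewrite (_ : (fun e => _) = fun=> 0); last by apply: funext => e; rewrite addr0.
move=> h; apply: funext => e; have := congr1 (fun k => k e) h.
by move=> /eqP; rewrite -subr_eq0 opprD addNKr oppr_eq0 => /eqP.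
Qed.

Let phi_mulD f d : steinberg f -> diagonal d -> phi (mulD f d) = mulD (phi f) (phi d).
Proof.
move=> sf dd; have s := steinberg_mulD hG1 sf dd.
apply: (conv_unique (phiM sf dd.1 s (conv_diag f dd.2))).
by apply: conv_diag; have [] := hD.1 _ dd.
Qed.

(** Additivity is applied to the decomposition of [f] into [mulD f d] and [mulCD f d]. *)
Let phi_mulCD f d : steinberg f -> diagonal d -> phi (mulCD f d) = mulCD (phi f) (phi d).
Proof.
move=> sf dd; have s := steinberg_mulD hG1 sf dd; have s' := steinberg_mulCD hG1 sf dd.
have := phiD s s'; rewrite mulD_mulCD phi_mulD // => h; apply: funext => e.
have := congr1 (fun k => k e) h; rewrite -{1}(mulD_mulCD (phi f) (phi d)).
by move/addrI.
Qed.

Let phi_idem d : diagonal d -> (idempotent_fun d <-> idempotent_fun (phi d)).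
Proof.
move=> dd; rewrite (idempotent_mulD dd) (idempotent_mulD (hD.1 _ dd)).
rewrite -phi_mulD //; last exact: dd.1.
split=> [->//|]; apply: phi_inj; last exact: dd.1.
by apply: steinberg_mulD => //; exact: dd.1.
Qed.

Let phi_half n m : steinberg n -> steinberg m -> half_normalising n m ->
  half_normalising (phi n) (phi m).
Proof.
move=> sn sm [[p [dp [cp cn]]] h]; split.
  exists (phi p); split; first exact: hD.1.
  by split; apply: phiM => //; exact: dp.1.
move=> d' /hD.2[d [dd <-]]; have [h1 [h2 [s1 [cc1 [cc2 d2]]]]] := h d dd.
exists (phi h1), (phi h2); split; first exact: phiS.
split; first by apply: phiM => //; exact: dd.1.
split; last exact: hD.1.
by apply: phiM => //; exact: d2.1.
Qed.

Let phi_bisection g n : bisection_unit c1 g n -> bisection_unit c2 g (phi n).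
Proof.
move=> /(bisection_normalising_pair hG1 hc1)[gn gm h1 h2].
apply: (normalising_pair_bisection hG2 hc2 hX2 hR2 (m := phi (inverse_unit n))).
by split; [exact: (hgr g).1|exact: (hgr _).1|exact: phi_half gn.1 gm.1 h1|exact: phi_half gm.1 gn.1 h2].
Qed.

Let bisection_unit_ind g (B : G1 -> Prop) : is_open (gtop G1) B -> compact (gtop G1) B ->
  bisection B -> (forall e, B e -> c1 e = g) -> bisection_unit c1 g (ind R B).
Proof.
move=> oB cB bB gB; split; [split; first exact: steinberg_ind| |].
- by rewrite supp_ind.
- by rewrite supp_ind.
- by move=> e /ind_supp Be; rewrite indT // unitr1.
Qed.

(* The preimage of an indicator function is a finite sum of scalar multiples of
   indicators of bisections, one of which must survive at the given point. *)
Let phi_cover (b : G2) : exists g n, bisection_unit c1 g n /\ phi n b <> 0.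
Proof.
have [B [oB cB Bb _ _]] := compact_open_bisection hG2 (open_full (gtop G2)) (Logic.I : (fun=> True) b).
have [f0 [sf0 f0B]] := hphi.2.2.1 _ (steinberg_ind R hG2 oB cB).
have f0b : phi f0 b <> 0 by rewrite f0B indT //; apply/eqP; rewrite oner_eq0.
pose J := {U : G1 -> Prop | [/\ is_open (gtop G1) U, compact (gtop G1) U, bisection U &
  exists g r, forall e, U e -> c1 e = g /\ f0 e = r]}.
have [||l hl] := sf0.2 J (fun j => sval j).
- by move=> [U []].
- move=> e _; have oO : is_open (gtop G1) (fun y => c1 y = c1 e /\ f0 y = f0 e).
    apply: open_inter; first exact: hc1.2.
    exact: (lconst_level (fun r => r = f0 e) sf0.1).
  have [U [oU cU Ue sU bU]] := compact_open_bisection hG1 oO (conj erefl erefl).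
  by unshelve eexists (exist _ U _) => //; split=> //; exists (c1 e), (f0 e).
(* Induction on the pieces: [f] is what remains of [f0] on those not yet removed. *)
suff key (l' : list J) f : steinberg f -> (forall e, f e <> 0 -> f e = f0 e) ->
    (forall e, f e <> 0 -> exists j, List.In j l' /\ sval j e) -> phi f b <> 0 ->
    exists g n, bisection_unit c1 g n /\ phi n b <> 0.
  exact: key sf0 (fun _ _ => erefl) hl f0b.
elim: l' f {hl} => [|[U [oU cU bU [g [r hU]]]] l' IH] f sf ff0 cf fb.
  case: fb; have -> : f = fun=> 0; last by rewrite phi0.
  by apply: funext => e; apply: contrapT => /cf[j []].
have lU : lconst (ind R U).
  by apply: lconst_ind => //; apply: compact_closed => //; exact: hG1.2.1.
pose f1 e := f e * ind R U e; pose f2 e := f e * (1 - ind R U e).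
have s1 : steinberg f1 by exact: steinberg_mul.
have s2 : steinberg f2.
  by apply: steinberg_mul => //; exact: (lconst_op2 (fun r _ => 1 - r) lU lU).
have ef : f = fun e => f1 e + f2 e.
  by apply: funext => e; rewrite /f1 /f2 -mulrDr subrKC mulr1.
have [f2b|f2b] := pselect (phi f2 b = 0); last first.
  apply: (IH f2) => // e f2e; have := f2e; rewrite /f2 => /mulr_neq0P[fe].
    have [Ue|nU] := pselect (U e); first by rewrite indT // subrr.
    by rewrite indF // subr0 mulr1 => _; exact: ff0.
  have [j [[<-|jl] je]] := cf _ fe; last by exists j.
  by move=> /=; rewrite indT ?subrr.
have f1b : phi f1 b <> 0.
  by move=> z; apply: fb; rewrite ef phiD // z f2b addr0.
have f1e e : f1 e <> 0 -> U e /\ f1 e = r.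
  move=> /mulr_neq0P[fe /ind_supp Ue]; split=> //.
  by rewrite /f1 indT // mulr1 ff0 //; have [] := hU _ Ue.
have oB1 : is_open (gtop G1) (supp f1) by exact: (lconst_level (fun r => r <> 0) s1.1).
have hn : bisection_unit c1 g (ind R (supp f1)).
  apply: bisection_unit_ind => //; first exact: s1.2.
    by apply: (bisection_sub _ bU) => e /f1e[].
  by move=> e /f1e[/hU[]].
pose K y := exists e, supp f1 e /\ y = gsource e.
have oK : is_open (gtop G1) K by exact: gsource_open.
have cK : compact (gtop G1) K.
  by apply: compact_image_fun s1.2 _ => V; exact: gsource_cont.
have dK : diagonal (ind R K) by apply: diagonal_ind => // y [e [_ ->]]; exact: unit_source.
(* [phi] is not assumed [R]-linear, so the scalar [r] enters through a diagonal element, whose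
   product with the indicator is [f1]. *)
pose d e := ind R K e * r.
have dd : diagonal d.
  split; last by move=> e /mulr_neq0P[/dK.2].
  apply: steinberg_mul dK.1 _ => e; exists (fun=> True); split=> //; exact: open_full.
exists g, (ind R (supp f1)); split=> // z; apply: f1b.
have -> : f1 = mulD (ind R (supp f1)) d.
  apply: funext => e; rewrite /mulD; have [h|/eqP h] := eqVneq (f1 e) 0.
    by rewrite h indF ?mul0r // => /(_ h).
  by rewrite indT // /d indT; [rewrite !mul1r; case: (f1e e h)|exists e].
rewrite phi_mulD //; last by case: hn => -[].
by rewrite /mulD z mul0r.
Qed.

(** One index set for both groupoids: a normaliser on [G1] indexes its own support and that of its
    image. *)
Let I : Type := {gn : Gam * (G1 -> R) | bisection_unit c1 gn.1 gn.2}.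
Let fn (i : I) : G1 -> R := (sval i).2.
Let U (i : I) (a : G1) : Prop := supp (fn i) a.
Let V (i : I) (b : G2) : Prop := supp (phi (fn i)) b.

Let fnP (i : I) : bisection_unit c1 (sval i).1 (fn i) := svalP i.

Let fnS (i : I) : steinberg (fn i).
Proof. by have [[]] := fnP i. Qed.

Let VP (i : I) : bisection (V i).
Proof. by have [] := phi_bisection (fnP i). Qed.

Let restrict (i : I) d (dd : diagonal d) (id : idempotent_fun d) : I :=
  exist _ ((sval i).1, mulD (fn i) d) (bisection_unit_mulD hG1 (fnP i) dd id).

Let corestrict (i : I) d (dd : diagonal d) (id : idempotent_fun d) : I :=
  exist _ ((sval i).1, mulCD (fn i) d) (bisection_unit_mulCD hG1 (fnP i) dd id).

Let splits_restrict (G : groupoid) (n n' d d' : G -> R) (i j i1 i2 : I) (W : I -> G -> Prop) :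
  W i = supp n -> W j = supp n' -> W i1 = supp (mulD n d) -> W i2 = supp (mulCD n d) ->
  idempotent_fun d -> mulD n d = mulD n' d' -> splits W i j i1 i2.
Proof.
rewrite /splits => -> -> -> -> id e; split=> x; last first.
- by rewrite /supp e => /mulr_neq0P[].
- by move=> /mulr_neq0P[].
- move=> /mulr_neq0P[_]; case: (idempotent_fun01 (gsource x) id) => // h _.
  by rewrite /supp /mulCD h subrr mulr0; apply.
- rewrite /supp /mulD /mulCD => nx.
  by case: (idempotent_fun01 (gsource x) id) => ->; rewrite ?subr0 ?mulr1; [right|left].
Qed.

(** One idempotent [d] cuts on both sides, since [phi] commutes with [mulD] and [mulCD]. *)
Let splits_agree (i j : I) d d' (dd : diagonal d) (id : idempotent_fun d) :
  diagonal d' -> mulD (fn i) d = mulD (fn j) d' ->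
  splits U i j (restrict i dd id) (corestrict i dd id) /\
  splits V i j (restrict i dd id) (corestrict i dd id).
Proof.
move=> dd' e; split; first exact: (splits_restrict (n := fn i) (n' := fn j) _ _ _ _ id e).
apply: (splits_restrict (n := phi (fn i)) (n' := phi (fn j)) (d := phi d) (d' := phi d')) => //.
- by rewrite /V /fn /= phi_mulD.
- by rewrite /V /fn /= phi_mulCD.
- exact/phi_idem.
- by rewrite -!phi_mulD // e.
Qed.

Let splitting_UV : splitting U V.
Proof.
move=> i j a Ui Uj.
have [d [d' [dd id da dd' e]]] := bisection_unit_agree hG1 (fnP i) (fnP j) Ui Uj.
have [s1 s2] := splits_agree dd id dd' e.
exists (restrict i dd id), (corestrict i dd id); split=> //.
by rewrite /U /supp /fn /= /mulD da mulr1.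
Qed.

(** The cutting elements are found on [G2] and pulled back through the diagonal; injectivity of
    [phi] pulls back the equation between the cut functions. *)
Let splitting_VU : splitting V U.
Proof.
move=> i j b Vi Vj.
have [d2 [d2' [dd2 id2 db dd2' e]]] :=
  bisection_unit_agree hG2 (phi_bisection (fnP i)) (phi_bisection (fnP j)) Vi Vj.
have [d [dd ed]] := hD.2 _ dd2; have [d' [dd' ed']] := hD.2 _ dd2'.
have id : idempotent_fun d by apply/phi_idem; rewrite ?ed.
have e' : mulD (fn i) d = mulD (fn j) d'.
  apply: phi_inj; [exact: steinberg_mulD|exact: steinberg_mulD|].
  by rewrite !phi_mulD // ed ed'.
have [s1 s2] := splits_agree dd id dd' e'.
exists (restrict i dd id), (corestrict i dd id); split=> //.
by rewrite /V /supp /fn /= phi_mulD // /mulD ed db mulr1.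
Qed.

(** [phi_cover] supplies some [V i] around [b]; the preimage of a diagonal indicator on [G2] then
    shrinks it into [O]. *)
Let V_basis (O : G2 -> Prop) b : is_open (gtop G2) O -> O b ->
  exists i, V i b /\ subset (V i) O.
Proof.
move=> oO Ob; have [g [n [hn nb]]] := phi_cover b.
pose i : I := exist _ (g, n) hn.
have [[s2 _] b2 _] := phi_bisection hn.
have os : is_open (gtop G2) (supp (phi n)) by exact: (lconst_level (fun r => r <> 0) s2.1).
have [W [oW Wb hW]] := shrink_source hG2 os b2.2 oO nb Ob.
have [K [oK cK Kb sK]] := compact_open_unit hG2 oW Wb (unit_source b).
have dK : diagonal (ind R K) by apply: diagonal_ind => // y /sK[].
have [d [dd ed]] := hD.2 _ dK.
have id : idempotent_fun d by apply/phi_idem; rewrite ?ed //; exact: idempotent_ind.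
have E : V (restrict i dd id) = supp (mulD (phi n) (ind R K)).
  by rewrite /V -ed -phi_mulD //; exact: (fnS i).
exists (restrict i dd id); rewrite E; split.
  by rewrite /supp /mulD indT // mulr1.
by move=> y /mulr_neq0P[ny /ind_supp Ky]; apply: hW => //; have [] := sK _ Ky.
Qed.

Let U_basis (O : G1 -> Prop) a : is_open (gtop G1) O -> O a ->
  exists i, U i a /\ subset (U i) O.
Proof.
move=> oO Oa; have oO' : is_open (gtop G1) (fun y => O y /\ c1 y = c1 a).
  by apply: open_inter => //; exact: hc1.2.
have [B [oB cB Ba sB bB]] := compact_open_bisection hG1 oO' (conj Oa erefl).
have hn : bisection_unit c1 (c1 a) (ind R B).
  by apply: bisection_unit_ind => // e /sB[].
exists (exist _ (c1 a, ind R B) hn); rewrite /U /fn /= supp_ind; split=> //.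
by move=> y /sB[].
Qed.

(** Multiplying normalisers is what makes the groupoid law visible to the index set. *)
Let product (i j : I) a b : gcomp a b -> U i a -> U j b ->
  exists k, U k (gmul a b) /\ conv (phi (fn i)) (phi (fn j)) (phi (fn k)).
Proof.
move=> ab Ua Ub; have [[si gi] bi ui] := fnP i; have [[sj gj] bj uj] := fnP j.
have [h [sh ch]] := conv_bisection hG1 si bi sj.
suff hh : bisection_unit c1 ((sval i).1 * (sval j).1)%g h.
  exists (exist _ (_, h) hh); split; last exact: phiM.
  by rewrite /U /supp /fn /= (conv_eval bi.1 ch) //; apply/mulr_neq0P.
split.
- split=> // e /(conv_neq0 ch)[x [y [xy <- hx hy]]].
  by rewrite (cocycleM hc1) // gi // gj.
- split=> e e' /(conv_neq0 ch)[x [y [xy <- hx hy]]] /(conv_neq0 ch)[x' [y' [xy' <- hx' hy']]].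
    rewrite !grangeM // => xx; have ex := bi.1 _ _ hx hx' xx; subst x'.
    by congr gmul; apply: bj.1 => //; move/gcompP: xy => <-; move/gcompP: xy' => <-.
  rewrite !gsourceM // => yy; have ey := bj.2 _ _ hy hy' yy; subst y'.
  by congr gmul; apply: bi.2 => //; move/gcompP: xy => ->; move/gcompP: xy' => ->.
- move=> e /(conv_neq0 ch)[x [y [xy <- hx hy]]].
  by rewrite (conv_eval bi.1 ch) // unitrM ui // uj.
Qed.

Lemma reconstruction :
  exists psi : G1 -> G2, groupoid_iso psi /\ forall e, c2 (psi e) = c1 e.
Proof.
have [] := @duality I G1 G2 (gtop G1) (gtop G2) U V hG1.2.1 hG2.2.1.
- by move=> i; apply: (lconst_level (fun r => r <> 0)); exact: (fnS i).1.
- by move=> i; apply: (lconst_level (fun r => r <> 0)); exact: (phiS (fnS i)).1.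
- by move=> i; exact: (fnS i).2.
- by move=> i; exact: (phiS (fnS i)).2.
- exact: U_basis.
- exact: V_basis.
(* A support is empty exactly when the function is zero, which [phi] preserves and reflects. *)
- move=> i; split=> -[x hx]; apply: contrapT => no; apply: hx.
    suff -> : fn i = fun=> 0 by [].
    apply: phi_inj; [exact: fnS|exact: steinberg0|rewrite phi0].
    by apply: funext => y; apply: contrapT => hy; apply: no; exists y.
  have -> : fn i = fun=> 0; last by rewrite phi0.
  by apply: funext => y; apply: contrapT => hy; apply: no; exists y.
- exact: splitting_UV.
- exact: splitting_VU.
move=> psi [k [psiK kK cpsi ck UV]].
have sep := hausdorff_basis_sep hG2.2.1 V_basis.
have prod i j a b : gcomp a b -> U i a -> U j b ->
    exists a' b', [/\ gcomp a' b', gmul a' b' = psi (gmul a b), V i a' & V j b'].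
  move=> ab Ua Ub; have [l [/UV Vl cl]] := product ab Ua Ub.
  exact: conv_neq0 cl Vl.
have hom a b : gcomp a b -> gcomp (psi a) (psi b) /\ psi (gmul a b) = gmul (psi a) (psi b).
  move=> ab; have [i [Ui _]] := U_basis (open_full (gtop G1)) (Logic.I : (fun=> True) a).
  have [j [Uj _]] := U_basis (open_full (gtop G1)) (Logic.I : (fun=> True) b).
  have [a0 [b0 [ab0 e0 Va0 Vb0]]] := prod _ _ _ _ ab Ui Uj.
  have ea : a0 = psi a.
    (* The factor [a0] a priori depends on [i] and [j]. Refining [i] inside [i'] gives a factor [a1]
       of the same range, equal to [a0] since [V i] is a bisection; so [a0] lies in every [V i']
       around [psi a]. *)
    apply: sep => i' /UV Ui'; have [i1 [i2 [Ui1 _ [_ _ s1 s2]]]] := splitting_UV Ui Ui'.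
    have [a1 [b1 [ab1 e1 Va1 Vb1]]] := prod _ _ _ _ ab Ui1 Uj.
    suff -> : a0 = a1 by exact: s2.
    by apply: (VP i).1 => //; [exact: s1|rewrite -(grangeM ab0) e0 -e1 grangeM].
  have eb : b0 = psi b.
    apply: sep => j' /UV Uj'; have [j1 [j2 [Uj1 _ [_ _ s1 s2]]]] := splitting_UV Uj Uj'.
    have [a1 [b1 [ab1 e1 Va1 Vb1]]] := prod _ _ _ _ ab Ui Uj1.
    suff -> : b0 = b1 by exact: s2.
    by apply: (VP j).2 => //; [exact: s1|rewrite -(gsourceM ab0) e0 -e1 gsourceM].
  by rewrite -ea -eb.
exists psi; split; last first.
  (* Both degrees are read off the degree recorded in an index [i] around [e]. *)
  move=> e; have [i [Ui _]] := U_basis (open_full (gtop G1)) (Logic.I : (fun=> True) e).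
  have [[_ g1] _ _] := fnP i; have [[_ g2] _ _] := phi_bisection (fnP i).
  by rewrite (g1 _ Ui) (g2 _ _) //; exact/UV.
split; [by exists k|split=> //; split=> a b; last by case/hom].
split=> [/hom[]//|h]; exact: (injective_hom_comp hom (can_inj psiK) h).
Qed.

End Reconstruction.

Theorem mainTheorem1 (R : idomainType) (star : {rmorphism R -> R})
  (star_invol : involutive star)
  (Gam : groupType) (G1 G2 : groupoid)
  (c1 : G1 -> Gam) (c2 : G2 -> Gam) (X1 : G1 -> Prop) (X2 : G2 -> Prop)
  (hG1 : ample_hausdorff G1) (hG2 : ample_hausdorff G2)
  (hc1 : cont_cocycle c1) (hc2 : cont_cocycle c2)
  (hX1 : dense_in_unit_space X1) (hX2 : dense_in_unit_space X2)
  (hR1 : forall x, X1 x ->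
     grring_nzd_trivial_units R (fun e => c1 e = @monoid.one Gam /\ isotropy x e) x)
  (hR2 : forall x, X2 x ->
     grring_nzd_trivial_units R (fun e => c2 e = @monoid.one Gam /\ isotropy x e) x) :
  [/\ ((exists psi : G1 -> G2, groupoid_iso psi /\ forall e, c2 (psi e) = c1 e) <->
       (exists phi : (G1 -> R) -> (G2 -> R), star_alg_iso (star : R -> R) phi /\ diagonal_preserving phi /\
                    graded c1 c2 phi)),
      ((exists phi : (G1 -> R) -> (G2 -> R), star_alg_iso (star : R -> R) phi /\ diagonal_preserving phi /\
                    graded c1 c2 phi) <->
       (exists phi : (G1 -> R) -> (G2 -> R), ring_iso phi /\ diagonal_preserving phi /\ graded c1 c2 phi)) &
      ((exists phi : (G1 -> R) -> (G2 -> R), ring_iso phi /\ diagonal_preserving phi /\ graded c1 c2 phi) <->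
       (exists psi : G1 -> G2, groupoid_iso psi /\ forall e, c2 (psi e) = c1 e))].
Proof.
have h12 : (exists psi : G1 -> G2, groupoid_iso psi /\ forall e, c2 (psi e) = c1 e) ->
    exists phi : (G1 -> R) -> (G2 -> R), star_alg_iso (star : R -> R) phi /\
      diagonal_preserving phi /\ graded c1 c2 phi.
  by move=> [psi [iso pc]]; exact: groupoid_iso_algebra iso pc.
have h23 : (exists phi : (G1 -> R) -> (G2 -> R), star_alg_iso (star : R -> R) phi /\
      diagonal_preserving phi /\ graded c1 c2 phi) ->
    exists phi : (G1 -> R) -> (G2 -> R), ring_iso phi /\ diagonal_preserving phi /\
      graded c1 c2 phi.
  by move=> [phi [[h _] hh]]; exists phi.
have h31 : (exists phi : (G1 -> R) -> (G2 -> R), ring_iso phi /\ diagonal_preserving phi /\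
      graded c1 c2 phi) ->
    exists psi : G1 -> G2, groupoid_iso psi /\ forall e, c2 (psi e) = c1 e.
  by move=> [phi [h [hd hg]]]; exact: (reconstruction hG1 hG2 hc1 hc2 hX2 hR2 h hd hg).
split.
- by split=> [/h12|/h23/h31].
- by split=> [/h23|/h31/h12].
- by split=> [/h31|/h12/h23].
Qed.
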